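(* Let $\Omega\subset\mathbb{R}^2$ be a bounded domain of genus $g$ such that the components of $\partial\Omega$ are simple closed curves $\gamma_0,\dots,\gamma_g$. Let $f:\overline{\Omega}\to\mathbb{R}$ be continuous. Then $s\leq 2(n+g-1)$, where $n$ is the number of nodal domains of $f$ in $\Omega$ and $s$ is the number of sign changes of $f$ along $\partial\Omega$.
   Context: A domain is an open connected set. Genus $g$ here means that $\partial\Omega$ has $g+1$ connected components (i.e. $\Omega$ has $g$ holes). The nodal domains of $f$ in $\Omega$ are the connected components of $\Omega\setminus\overline{\{z\in\Omega: f(z)=0\}}$. For a simple closed curve $\gamma$, the number of sign changes of $f$ on $\gamma$ is the largest integer $m$ such that there exist $m$ points $p_1,\dots,p_m$ on $\gamma$, listed in cyclic order, with $f(p_k)\neq0$ for all $k$ and $f(p_k)$, $f(p_{k+1})$ of opposite signs for all $k$ (indices mod $m$), or $0$ if no such points with $m\ge2$ exist; the number $s$ of sign changes of $f$ along $\partial\Omega$ is the sum over $i=0,\dots,g$ of the numbers of sign changes of $f$ on $\gamma_i$.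
   Formalization: When n = g = 0 (f identically zero on a domain of genus 0) the bound 2(n+g−1) = −2 fails since s = 0; in that case the bound is read as 0. *)

(* Defs.v *)
From HB Require Import structures.
From mathcomp Require Import all_boot all_order all_algebra.
From mathcomp Require Import all_classical all_reals all_analysis.
Set Implicit Arguments. Unset Strict Implicit. Unset Printing Implicit Defensive.
Import Order.TTheory GRing.Theory Num.Theory numFieldNormedType.Exports.
Local Open Scope classical_set_scope.
Local Open Scope ring_scope.

Section Defs.
Variable R : realType.
Local Notation P := (R * R)%type.

Definition bounded_plane (A : set P) : Prop :=
  exists M : R, forall z, A z -> `|z.1| <= M /\ `|z.2| <= M.

Definition domain (A : set P) : Prop := [/\ open A, connected A & A !=set0].

Definition plane_boundary (A : set P) : set P := closure A `\` interior A.

Definition components (A : set P) : set (set P) :=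
  [set connected_component A x | x in A].

Definition simple_closed_param (gam : R -> P) : Prop :=
  [/\ {within `[0, 1], continuous gam}, gam 0 = gam 1 &
      {in `[0, 1[ &, injective gam}].

Definition trace (gam : R -> P) : set P := gam @` `[0, 1].

Definition nodal_domains (f : P -> R) (Omega : set P) : set (set P) :=
  components (Omega `\` closure [set z | Omega z /\ f z = 0]).

(* f has (at least) m sign changes on the closed curve gam: there are
   m points gam(t_0), ..., gam(t_{m-1}) with 0 <= t_0 < ... < t_{m-1} < 1
   (hence in cyclic order along the curve), at which f is nonzero and with
   cyclically consecutive values of opposite signs. *)
Definition has_sign_changes (f : P -> R) (gam : R -> P) (m : nat) : Prop :=
  exists t : nat -> R,
    [/\ forall k, (k < m)%N -> 0 <= t k < 1,
        forall k, (k.+1 < m)%N -> t k < t k.+1,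
        forall k, (k < m)%N -> f (gam (t k)) != 0 &
        forall k, (k < m)%N -> f (gam (t k)) * f (gam (t (k.+1 %% m)%N)) < 0].

End Defs.

(* Main.v *)
Require Import Defs.
From HB Require Import structures.
From mathcomp Require Import all_boot all_order all_algebra.
From mathcomp Require Import all_classical all_reals all_analysis.
From mathcomp Require Import ring lra.
Import Order.TTheory GRing.Theory Num.Theory numFieldNormedType.Exports.
Local Open Scope classical_set_scope.
Local Open Scope ring_scope.
Local Open Scope card_scope.

(** Idea.  The rotation of a closed chain of paths, seen from a point off the
    chain, is a locally constant function of that point; it is computed here
    by counting signed crossings of a half-axis, so no angle is needed.

    Let [k] be the number of positive sign points on the boundary, half of the
    number of sign changes, and give them real weights [c] such that the
    weights have sum zero on each boundary curve and on each positive nodal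
    domain (a positive point belonging to a nodal domain that reaches it).
    Then the paths which lead, with weight [c p], from a base point of the
    domain of [p] to [p] and further along the curve to its origin form a
    cycle, whose rotation [w] is constant on each negative nodal domain.
    Require moreover that [w] take the same value on all of these.  As one of
    the conditions on the positive domains is redundant, this is a system of
    [n + g - 1] equations.  If [k > n + g - 1] it has a nonzero solution.  But
    [w] is also constant on the side of each curve opposite to [Omega], and
    near a negative point [q] of the curve it jumps across the curve by a
    nonzero constant times the sum of the weights preceding [q].  Hence these
    partial sums do not depend on [q], so all the weights vanish. *)
(** * Linear algebra and cyclic sequences *)

Section Combinatorics.
Set Implicit Arguments.
Unset Strict Implicit.
Unset Printing Implicit Defensive.
Lemma underdetermined (F : fieldType) (I J : finType) (A : {set I})
    (B : {set J}) (a : I -> J -> F) : (#|B| < #|A|)%N ->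
  exists c : I -> F, (exists2 i, i \in A & c i != 0) /\
    forall j, j \in B -> \sum_(i in A) c i * a i j = 0.
Proof.
move=> BA; pose X := (\matrix_(i < #|A|, j < #|B|) a (enum_val i) (enum_val j))%R.
have : kermx X != 0.
  rewrite -mxrank_eq0 mxrank_ker subn_eq0 -ltnNge.
  exact: leq_ltn_trans (rank_leq_col _) BA.
case/rowV0Pn => v /sub_kermxP vX /rV0Pn[i0 vi0].
have i0A := enum_valP i0.
exists (fun i => v 0 (enum_rank_in i0A i)); split.
  by exists (enum_val i0); rewrite ?enum_valK_in.
move=> j jB; have := congr1 (fun Y : 'rV_#|B| => Y 0 (enum_rank_in jB j)) vX.
rewrite !mxE => e; rewrite -[RHS]e big_enum_val; apply: eq_bigr => i _.
by rewrite mxE enum_valK_in enum_rankK_in.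
Qed.

(** The cyclic successor permutes the indices and exchanges the two values of [s]. *)
Lemma card_alternating (m : nat) (s : nat -> bool) :
  (forall k, (k < m)%N -> s (k.+1 %% m)%N = ~~ s k) ->
  (2 * \sum_(k < m) s k = m)%N.
Proof.
move=> alt; rewrite mul2n -addnn.
have {2}-> : (\sum_(k < m) s k = \sum_(k < m) ~~ s k)%N.
  rewrite (reindex (@ordS m)) /=; last exact/onW_bij/ordS_bij.
  by apply: eq_bigr => k _; rewrite alt.
rewrite -big_split /= (eq_bigr (fun=> 1%N)); last by move=> k _; case: (s k).
by rewrite sum1_card card_ord.
Qed.

(* The partial sums are constant along the indices where [c] is forced to
   vanish, and every other index is cyclically between two of those. *)
Lemma alternating_partial_sums (V : zmodType) (m : nat) (s : nat -> bool)
    (c : nat -> V) :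
  (forall k, (k < m)%N -> s (k.+1 %% m)%N = ~~ s k) ->
  (forall k, (k < m)%N -> ~~ s k -> c k = 0) ->
  \sum_(k < m) c k = 0 ->
  (forall k l, (k < m)%N -> (l < m)%N -> ~~ s k -> ~~ s l ->
     \sum_(j < k) c j = \sum_(j < l) c j) ->
  forall k, (k < m)%N -> c k = 0.
Proof.
move=> alt c0 sum0 par k km; have [sk|] := boolP (s k); last exact: c0.
have step j : (j.+1 < m)%N -> s j.+1 = ~~ s j.
  by move=> jm; rewrite -alt ?(ltnW jm) // modn_small.
have wrap : s 0%N = ~~ s m.-1.
  by rewrite -alt; case: (m) km => // n; rewrite /= ?modnn.
(* The cyclic neighbours of index 0 are 1 and [m.-1]: the partial sum before 1 is [c 0], the one
   before [m.-1] is the total, hence 0. For [m = 1] alternation is contradictory. *)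
case: k km sk => [|k] km sk.
  have [m2|] := ltnP 1 m; last first.
    case: m km alt c0 sum0 par step wrap => // -[|//] _ _ _ _ _ _ /=.
    by rewrite sk.
  have n1 : ~~ s 1%N by rewrite step // sk.
  have nm : ~~ s m.-1 by rewrite -wrap.
  have := par 1%N m.-1 m2 _ n1 nm; rewrite big_ord1 => /= ->.
    have : \sum_(k < m.-1.+1) c k = 0 by rewrite prednK.
    by rewrite big_ord_recr /= c0 ?addr0 // prednK.
  by rewrite prednK.
have nk : ~~ s k by move: sk; rewrite step.
have [k2m|mk] := ltnP k.+2 m.
  have nk2 : ~~ s k.+2 by rewrite step // sk.
  have := par k.+2 k k2m (ltnW km) nk2 nk.
  rewrite !big_ord_recr /= (c0 k) ?(ltnW km) // addr0 => /eqP.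
  by rewrite -subr_eq0 addrAC subrr add0r => /eqP.
have mE : m = k.+2 by apply/eqP; rewrite eqn_leq mk.
have n0 : ~~ s 0%N by rewrite wrap mE /= sk.
have := par k 0%N (ltnW km) (leq_ltn_trans (leq0n _) km) nk n0.
rewrite big_ord0 => p0; move: sum0; rewrite mE !big_ord_recr /= p0 add0r.
by rewrite (c0 k) ?(ltnW km) // add0r.
Qed.

Lemma card_eq_enum (T : Type) (S : set T) (n : nat) : S #= `I_n ->
  exists e : 'I_n -> T, (forall j, S (e j)) /\ forall x, S x -> exists j, e j = x.
Proof.
rewrite card_eq_sym => /card_bijP[h hb].
have jn (j : 'I_n) : val j \in `I_n by rewrite inE /=.
exists (fun j => set_val (h (SigSub (jn j)))); split.
  by move=> j; exact: set_valP.
move=> x Sx; have xS : x \in S by rewrite inE.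
have [g gK hK] := hb.
have gn : (val (g (SigSub xS)) < n)%N by have := valP (g (SigSub xS)); rewrite inE.
exists (Ordinal gn).
have -> : SigSub (jn (Ordinal gn)) = g (SigSub xS) by exact: val_inj.
by rewrite hK.
Qed.

End Combinatorics.

(** * Winding of a path around the origin *)

Section Winding.
Set Implicit Arguments.
Unset Strict Implicit.
Unset Printing Implicit Defensive.
Variable R : realType.
Local Notation P := (R * R)%type.
Implicit Types (u v w z : P) (s t : R -> P) (a b c d e : R).

(** Short intervals around the supremum of the [c] with [Q a c] satisfy [Q], so it is attained and
    cannot lie below [b]. Compactness of an interval is mostly used in this form. *)
Lemma cousin (Q : R -> R -> Prop) a b : a <= b ->
  (forall c, a <= c <= b -> exists2 d, 0 < d & forall l r,
     a <= l -> l <= c -> c <= r -> r <= b -> c - d < l -> r < c + d -> Q l r) ->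
  (forall l c r, a <= l -> l <= c -> c <= r -> r <= b ->
     Q l c -> Q c r -> Q l r) ->
  Q a b.
Proof.
move=> ab loc glue.
pose S := [set c | a <= c <= b /\ Q a c].
have Sa : S a.
  split; first by rewrite lexx.
  have [|d d0 H] := loc a; first by rewrite lexx.
  by apply: H; rewrite ?lexx //; lra.
have hS : has_sup S by split; [exists a | exists b => c [/andP[]]].
have ubS := sup_upper_bound hS.
have sb : sup S <= b by apply: ge_sup; [exists a|move=> c [/andP[]]].
have sa : a <= sup S by exact: ubS.
have [|d d0 H] := loc (sup S); first by rewrite sa.
have [c [/andP[ac cb] Qac] ltc] := sup_adherent d0 hS.
have cs : c <= sup S by apply: ubS; split => //; rewrite ac.
(* This point goes beyond the supremum unless cut off at [b]; as it belongs to [S], it is [b]. *)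
pose r := Num.min b (sup S + d / 2).
have sr : sup S <= r by rewrite /r le_min sb /=; lra.
have rb : r <= b by rewrite /r ge_min lexx.
have Sr : S r.
  split; first by rewrite (le_trans sa sr) rb.
  apply: (glue a c r) => //; first exact: le_trans cs sr.
  apply: H => //.
  by rewrite /r gt_min; apply/orP; right; lra.
have rs : r <= sup S by exact: ubS.
suff <- : r = b by case: Sr.
apply/eqP; rewrite eq_le rb /=; move: rs; rewrite /r.
by rewrite ge_min => /orP[|] ? //; [rewrite le_min lexx /=; lra|lra].
Qed.

Definition cont_on (X : normedModType R) (s : R -> X) a b := forall c, a <= c <= b ->
  forall e, 0 < e -> exists2 d, 0 < d &
  forall r, a <= r <= b -> `|r - c| < d -> `|s r - s c| < e.

Lemma cont_on_sub (X : normedModType R) (s : R -> X) a b c d :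
  a <= c -> d <= b -> cont_on s a b -> cont_on s c d.
Proof.
move=> ac db cs r /andP[cr rd] e e0.
have [|q q0 H] := cs r _ e e0; first by rewrite (le_trans ac) ?(le_trans rd).
by exists q => // r' /andP[? ?]; apply: H; rewrite (le_trans ac) ?(le_trans _ db).
Qed.

Lemma locally_constant_itv (T : Type) (g : R -> T) a b : a <= b ->
  (forall c, a <= c <= b -> exists2 d, 0 < d &
     forall r, a <= r <= b -> `|r - c| < d -> g r = g c) -> g a = g b.
Proof.
move=> ab H; apply: (@cousin (fun l r => g l = g r) a b ab); last first.
  by move=> l c r _ _ _ _ -> ->.
move=> c cab; have [d d0 K] := H c cab; exists d => // l r al lc cr rb dl rd.
rewrite !K ?ltr_norml ?al ?(le_trans lc) ?(le_trans cr) ?rb ?(le_trans al) //;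
  try lra.
Qed.

Definition upper u : R := (0 <= u.2)%R%:R.

(* The signed number of crossings of the open right half-axis by a step from
   [u] to [v], for steps short compared to the distance to the origin. *)
Definition crossing u v : R := if 0 < u.1 then upper v - upper u else 0.

Lemma norm_pairE u : `|u| = Num.max `|u.1| `|u.2|.
Proof. by rewrite prod_normE. Qed.

Lemma norm_pair_lt u e : (`|u| < e) = (`|u.1| < e) && (`|u.2| < e).
Proof. by rewrite norm_pairE gt_max. Qed.

(** Points closer to [z] than a third of its sup norm share with [z] the sign of one coordinate. On
    such a half-plane [crossing] is zero or a difference of values of [upper], hence additive. *)
Lemma crossing_add z u v w : 3 * `|u - z| < `|z| -> 3 * `|v - z| < `|z| ->
  3 * `|w - z| < `|z| -> crossing u v + crossing v w = crossing u w.
Proof.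
move=> hu hv hw.
have [d d0 zd]: exists2 d, 0 < d & `|z| = 3 * d.
  exists (`|z| / 3); last by field.
  by have := normr_ge0 (u - z); lra.
have {hu}: `|u - z| < d by lra.
have {hv}: `|v - z| < d by lra.
have {hw}: `|w - z| < d by lra.
rewrite !norm_pair_lt /= => /andP[w1 w2] /andP[v1 v2] /andP[u1 u2].
have [z2|z2] := lerP (3 * d) `|z.2|.
  have [z0|z0] := lerP 0 z.2.
    rewrite ger0_norm // in z2.
    have up (x : P) : `|x.2 - z.2| < d -> upper x = 1.
      rewrite ltr_norml => /andP[? ?]; rewrite /upper; suff -> : 0 <= x.2 by [].
      by lra.
    by rewrite /crossing !up // subrr !if_same addr0.
  rewrite ltr0_norm // in z2.
  have up (x : P) : `|x.2 - z.2| < d -> upper x = 0.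
    rewrite ltr_norml => /andP[? ?]; rewrite /upper leNgt; suff -> : x.2 < 0 by [].
    by lra.
  by rewrite /crossing !up // subrr !if_same addr0.
have z1 : `|z.1| = 3 * d.
  by move: zd; rewrite norm_pairE /Num.max; case: ifP => // _ h; move: z2; rewrite h ltxx.
have [z0|z0] := lerP 0 z.1.
  rewrite ger0_norm // in z1.
  have rg (x : P) : `|x.1 - z.1| < d -> 0 < x.1.
    by rewrite ltr_norml => /andP[? ?]; lra.
  by rewrite /crossing !rg //; ring.
rewrite ltr0_norm // in z1.
have rg (x : P) : `|x.1 - z.1| < d -> (0 < x.1) = false.
  by rewrite ltr_norml => /andP[? ?]; apply/negbTE; rewrite -leNgt; lra.
by rewrite /crossing !rg // addr0.
Qed.

(** A lift replaces a continuous choice of the argument: its local increments are signed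
    crossings. *)
Definition is_lift s a b (l : R -> R) := forall c, a <= c <= b ->
  exists2 d, 0 < d & forall r, a <= r <= b -> `|r - c| < d ->
    l r - l c = crossing (s c) (s r).

Definition avoids s a b := forall c, a <= c <= b -> s c != 0.

Lemma avoids_sub s a b c d :
  a <= c -> d <= b -> avoids s a b -> avoids s c d.
Proof.
move=> ac db h r /andP[cr rd]; apply: h.
by rewrite (le_trans ac cr) (le_trans rd db).
Qed.

(** Near [c] the crossings counted from [s c] form a lift, by [crossing_add]; lifts on adjacent
    intervals are glued after shifting one of them by a constant. *)
Lemma lift_exists s a b : a <= b -> cont_on s a b -> avoids s a b ->
  exists l, is_lift s a b l.
Proof.
move=> ab cs s0.
pose Q x y := a <= x -> x <= y -> y <= b -> exists l, is_lift s x y l.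
suff : Q a b by apply.
apply: cousin => // [c cab|x c y ax xc cy yb h1 h2 _ _ _].
  have e0 : 0 < `|s c| / 3 by rewrite divr_gt0 // normr_gt0 s0.
  have [d d0 H] := cs c cab _ e0.
  exists d => // x y ax xc cy yb dx yd _ _ _.
  exists (fun r => crossing (s c) (s r)) => r /andP[xr ry].
  have near q : x <= q <= y -> 3 * `|s q - s c| < `|s c|.
    move=> /andP[xq qy].
    have : `|s q - s c| < `|s c| / 3.
      apply: H; first by rewrite (le_trans ax xq) (le_trans qy yb).
      by rewrite ltr_norml; apply/andP; split; lra.
    by lra.
  exists 1 => // q xqy _; rewrite -[in LHS](@crossing_add (s c) (s c) (s r) (s q)).
  - by rewrite addrC addKr.
  - by rewrite subrr normr0 mulr0 normr_gt0 s0.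
  - by apply: near; rewrite xr.
  - exact: near.
have [l hl] := h1 ax xc (le_trans cy yb).
have [m hm] := h2 (le_trans ax xc) cy yb.
exists (fun r => if r <= c then l r else m r - m c + l c) => q /andP[xq qy].
have [qc|cq|->] := ltgtP q c.
- have [|d d0 H] := hl q; first by rewrite xq ltW.
  exists (Num.min d (c - q)); first by rewrite lt_min d0 subr_gt0.
  move=> r /andP[xr ry]; rewrite lt_min => /andP[rd rq].
  have rc : r <= c by move: rq; rewrite ltr_norml => /andP[? ?]; lra.
  by rewrite rc; apply: H => //; rewrite xr.
- have [|d d0 H] := hm q; first by rewrite qy ltW.
  exists (Num.min d (q - c)); first by rewrite lt_min d0 subr_gt0.
  move=> r /andP[xr ry]; rewrite lt_min => /andP[rd rq].
  have cr : c < r by move: rq; rewrite ltr_norml => /andP[? ?]; lra.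
  rewrite leNgt cr /= -H //; last by rewrite ry ltW.
  by ring.
- have [|d d0 H] := hl c; first by rewrite xc lexx.
  have [|d' d'0 H'] := hm c; first by rewrite cy lexx.
  exists (Num.min d d'); first by rewrite lt_min d0.
  move=> r /andP[xr ry]; rewrite lt_min => /andP[rd rd'].
  have [rc|cr] := leP r c; first by apply: H => //; rewrite xr.
  by rewrite -H' //; [ring|rewrite ry ltW].
Qed.

Lemma lift_unique s a b l m : a <= b -> is_lift s a b l -> is_lift s a b m ->
  l b - l a = m b - m a.
Proof.
move=> ab hl hm.
suff : l a - m a = l b - m b by lra.
apply: (@locally_constant_itv _ (fun r => l r - m r)) => // c cab.
have [d d0 H] := hl c cab; have [d' d'0 H'] := hm c cab.
exists (Num.min d d'); first by rewrite lt_min d0.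
move=> r rab; rewrite lt_min => /andP[rd rd'].
by have := H r rab rd; have := H' r rab rd'; lra.
Qed.

(** By [lift_unique] the value does not depend on the lift chosen; without a lift, the default gives
    0. *)
Definition winding s a b : R :=
  let l := xget (fun=> 0) [set l | is_lift s a b l] in l b - l a.

Lemma windingE s a b l : a <= b -> is_lift s a b l -> winding s a b = l b - l a.
Proof.
move=> ab hl; rewrite /winding; case: xgetP => [m _ hm|/(_ l)//].
exact: lift_unique hm hl.
Qed.

Lemma is_lift_sub s a b c d l :
  a <= c -> d <= b -> is_lift s a b l -> is_lift s c d l.
Proof.
move=> ac db hl r /andP[cr rd].
have [|q q0 H] := hl r; first by rewrite (le_trans ac cr) (le_trans rd db).
by exists q => // r' /andP[? ?]; apply: H; rewrite (le_trans ac) ?(le_trans _ db).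
Qed.

Lemma winding_cat s a c b : a <= c -> c <= b -> cont_on s a b -> avoids s a b ->
  winding s a c + winding s c b = winding s a b.
Proof.
move=> ac cb cs s0; have ab := le_trans ac cb.
have [l hl] := lift_exists ab cs s0.
rewrite (windingE ab hl) (windingE ac (is_lift_sub (lexx _) cb hl)).
by rewrite (windingE cb (is_lift_sub ac (lexx _) hl)) addrC addrA subrK.
Qed.

(** Here and in the next two lemmas a lift is explicit. They evaluate the rotation of a square and
    that of a curve seen from afar. *)
Lemma winding_right s a b : a <= b -> (forall c, a <= c <= b -> 0 < (s c).1) ->
  winding s a b = upper (s b) - upper (s a).
Proof.
move=> ab h; rewrite (@windingE _ _ _ (upper \o s)) //= => c cab.
by exists 1 => // r rab _; rewrite /crossing h.
Qed.

Lemma winding_left s a b : a <= b -> (forall c, a <= c <= b -> (s c).1 <= 0) ->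
  winding s a b = 0.
Proof.
move=> ab h; rewrite (@windingE _ _ _ (fun=> 0)) ?subrr //= => c cab.
by exists 1 => // r rab _; rewrite /crossing ltNge h // subrr.
Qed.

Lemma winding_upper s a b k : a <= b ->
  (forall c, a <= c <= b -> upper (s c) = k) -> winding s a b = 0.
Proof.
move=> ab h; rewrite (@windingE _ _ _ (fun=> 0)) ?subrr //= => c cab.
by exists 1 => // r rab _; rewrite /crossing !h // !subrr if_same.
Qed.

Lemma avoids_lower s a b : a <= b -> cont_on s a b -> avoids s a b ->
  exists2 e, 0 < e & forall c, a <= c <= b -> e <= `|s c|.
Proof.
move=> ab cs s0.
apply: (@cousin (fun l r => exists2 e, 0 < e &
  forall c, l <= c <= r -> e <= `|s c|) a b ab) => [c cab|l c r _ _ _ _].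
  have e0 : 0 < `|s c| / 2 by rewrite divr_gt0 // normr_gt0 s0.
  have [d d0 H] := cs c cab _ e0.
  exists d => // l r al lc cr rb dl rd; exists (`|s c| / 2) => // q /andP[lq qr].
  have : `|s q - s c| < `|s c| / 2.
    apply: H; first by rewrite (le_trans al lq) (le_trans qr rb).
    by rewrite ltr_norml; apply/andP; split; lra.
  by have := lerB_dist (s c) (s q); rewrite distrC; lra.
move=> [e e0 h] [e' e'0 h']; exists (Num.min e e'); first by rewrite lt_min e0.
move=> q /andP[lq qr]; rewrite ge_min.
have [qc|cq] := leP q c; first by rewrite h // lq.
by rewrite h' ?orbT // ltW.
Qed.

(* The defect is the rotation of the straight steps joining the endpoints. *)
Lemma winding_near s a b : a <= b -> cont_on s a b -> avoids s a b ->
  exists2 e, 0 < e & forall t, cont_on t a b ->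
    (forall c, a <= c <= b -> `|t c - s c| < e) ->
    winding t a b - winding s a b = crossing (s b) (t b) - crossing (s a) (t a).
Proof.
move=> ab cs s0; have [d d0 hd] := avoids_lower ab cs s0.
(* A sixth for the distance between the paths and a sixth for the variation of [s] make up the third
   allowed by [crossing_add]. *)
exists (d / 6); first by rewrite divr_gt0.
move=> t ct ts.
have t0 : avoids t a b.
  move=> c cab; apply/eqP => tc; have := ts c cab; have := hd c cab.
  by rewrite tc sub0r normrN; lra.
have [l hl] := lift_exists ab cs s0; have [m hm] := lift_exists ab ct t0.
rewrite (windingE ab hl) (windingE ab hm).
suff : m a - l a - crossing (s a) (t a) = m b - l b - crossing (s b) (t b) by lra.
apply: (@locally_constant_itv _ (fun r => m r - l r - crossing (s r) (t r))) => //.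
move=> c cab.
have [d1 d10 h1] := hl c cab; have [d2 d20 h2] := hm c cab.
have [|d3 d30 h3] := cs c cab (d / 6); first by rewrite divr_gt0.
exists (Num.min d1 (Num.min d2 d3)); first by rewrite !lt_min d10 d20.
move=> r rab; rewrite !lt_min => /and3P[r1 r2 r3].
have := h1 r rab r1; have := h2 r rab r2.
have nc := hd c cab.
have near0 : 3 * `|s c - s c| < `|s c| by rewrite subrr normr0; lra.
have near1 : 3 * `|t c - s c| < `|s c| by have := ts c cab; lra.
have sr := h3 r rab r3.
have near2 : 3 * `|s r - s c| < `|s c| by lra.
have near3 : 3 * `|t r - s c| < `|s c|.
  have := ler_distD (s r) (t r) (s c); have := ts r rab; lra.
have := crossing_add near0 near1 near3; have := crossing_add near0 near2 near3.
lra.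
Qed.

End Winding.

(** * Topology of the plane *)

Section PlaneTopology.
Set Implicit Arguments.
Unset Strict Implicit.
Unset Printing Implicit Defensive.
Variable R : realType.
Local Notation P := (R * R)%type.
Implicit Types (u v w z : P) (s t : R -> P) (a b c d e : R).

(** A level set is open and closed in [A]. The target is any type, so that truth values propagate as
    well as numbers. *)
Lemma connected_locally_constant (T : topologicalType) (Y : Type) (A : set T)
    (g : T -> Y) : connected A ->
  (forall x, A x -> \forall z \near x, A z -> g z = g x) ->
  forall x y, A x -> A y -> g x = g y.
Proof.
move=> cA loc x y Ax Ay.
suff AE : A `&` [set z | g z = g x] = A by move: Ay; rewrite -AE => -[].
apply: cA; first by exists x.
  exists (interior [set z | A z -> g z = g x]); first exact: open_interior.
  apply/seteqP; split=> z [Az] /=.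
    by move=> gz; split=> //; near=> w => Aw; rewrite -gz; move: Aw; near: w; exact: loc.
  by move=> /nbhs_singleton /(_ Az).
exists (~` interior [set z | A z -> g z <> g x]).
  by apply: open_closedC; exact: open_interior.
apply/seteqP; split=> z [Az] /=.
  by move=> gz; split=> // /nbhs_singleton /(_ Az).
move=> h; split=> //; apply: contrapT => gz; apply: h.
near=> w => Aw; suff -> : g w = g z by [].
by move: Aw; near: w; exact: loc.
Unshelve. all: by end_near. Qed.

Lemma within_cont_on (X : normedModType R) (s : R -> X) a b :
  {within `[a, b], continuous s} -> cont_on s a b.
Proof.
move=> /subspace_continuousP cs c cab e e0.
have /cvgrPdist_lt /(_ e e0) : s @ within `[a, b] (nbhs c) --> s c.
  by apply: cs; rewrite /= in_itv.
rewrite /within => /nbhs_normP[d /= d0 H]; exists d; first exact: d0.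
move=> r rab rd.
have := H r; rewrite /= in_itv /= rab.
rewrite distrC => /(_ rd isT).
by rewrite distrC.
Qed.

Lemma continuous_cont_on (X : normedModType R) (s : R -> X) a b :
  continuous s -> cont_on s a b.
Proof. by move=> cs; apply: within_cont_on; exact: continuous_subspaceT. Qed.

Lemma cont_on_addr s a b z : cont_on s a b -> cont_on (fun r => s r - z) a b.
Proof.
move=> cs c cab e e0; have [d d0 H] := cs c cab e e0; exists d => // r rab rd.
by rewrite opprB addrA subrK; exact: H.
Qed.

Lemma cont_on_comp (r : P -> P) s a b : continuous r -> cont_on s a b ->
  cont_on (r \o s) a b.
Proof.
move=> cr cs c cab e e0.
have /cvgrPdist_lt /(_ e e0)/nbhs_normP[d /= d0 H] := cr (s c).
have [d' d'0 H'] := cs c cab d d0; exists d'; first exact: d'0.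
move=> q qab qd.
by have := H (s q); rewrite /= distrC H' // => /(_ isT); rewrite distrC.
Qed.

Definition segment u v (r : R) : P := u + r *: (v - u).

Lemma segment_continuous u v : continuous (segment u v).
Proof.
move=> r; apply: cvgD; first exact: cvg_cst.
by apply: cvgZr_tmp; exact: cvg_id.
Qed.

Lemma connected_segment u v : connected (segment u v @` `[0, 1]).
Proof.
apply: connected_continuous_connected.
  by apply/connected_intervalP; exact: interval_is_interval.
exact/continuous_subspaceT/segment_continuous.
Qed.

Lemma convex_connected (A : set P) :
  (forall u v, A u -> A v -> forall r, 0 <= r <= 1 -> A (segment u v r)) ->
  connected A.
Proof.
move=> cA; have [->|/set0P[u Au]] := eqVneq A set0; first exact: connected0.
have -> : A = \bigcup_(v in A) (segment u v @` `[0, 1]).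
  apply/seteqP; split=> [v Av|_ [v Av [r r01 <-]]].
    exists v => //; exists 1; first by rewrite /= in_itv /= ler01 lexx.
    by rewrite /segment scale1r addrC subrK.
  by apply: cA => //; rewrite /= in_itv in r01.
apply: bigcup_connected; last by move=> v _; exact: connected_segment.
exists u => v Av; exists 0; first by rewrite /= in_itv /= ler01 lexx.
by rewrite /segment scale0r addr0.
Qed.

Lemma ball_segment z e u v r : ball z e u -> ball z e v -> 0 <= r <= 1 ->
  ball z e (segment u v r).
Proof.
rewrite -!ball_normE /= => zu zv /andP[r0 r1].
have -> : z - segment u v r = (1 - r) *: (z - u) + r *: (z - v).
  rewrite /segment; case: z u v {zu zv} => [z1 z2] [u1 u2] [v1 v2].
  by congr (_, _); rewrite /= /GRing.scale /=; ring.
apply: (le_lt_trans (ler_normD _ _)); rewrite !normrZ !ger0_norm ?subr_ge0 //.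
have [->|rn] := eqVneq r 1; first by rewrite subrr mul0r add0r mul1r.
have r1' : 0 < 1 - r by rewrite subr_gt0 lt_neqAle rn.
have h1 : (1 - r) * `|z - u| < (1 - r) * e by rewrite ltr_pM2l.
have h2 : r * `|z - v| <= r * e by rewrite ler_wpM2l // ltW.
by lra.
Qed.

Lemma connected_ball z e : connected (ball z e).
Proof. by apply: convex_connected => u v zu zv r; exact: ball_segment. Qed.

Lemma component_open (A : set P) z : open A -> open (connected_component A z).
Proof.
rewrite !openE => oA w Aw; have /oA := connected_component_sub Aw.
rewrite /interior => /nbhs_ballP[e /= e0 eA].
apply/nbhs_ballP; exists e => // w' ww'; apply: connected_component_trans Aw _.
exists (ball w e) => //; split => //; first exact: ballxx.
exact: connected_ball.
Qed.

End PlaneTopology.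

(** * The rotation of a path as a function of the viewpoint *)

Section Rotation.
Set Implicit Arguments.
Unset Strict Implicit.
Unset Printing Implicit Defensive.
Variable R : realType.
Local Notation P := (R * R)%type.
Implicit Types (u v w z : P) (s t : R -> P) (a b c d e : R) (K : set P).

(* [W x] behaves as the rotation, seen from [x], of a path from [u] to [v]
   with support in [K]. *)
Definition angle_fun (W : P -> R) K u v := forall x, ~ K x ->
  \forall z \near x, ~ K z /\
    W z - W x = crossing (v - x) (v - z) - crossing (u - x) (u - z).

(** Moving the viewpoint translates the path, so [winding_near] applies. *)
Lemma path_angle_fun s a b : a <= b -> cont_on s a b ->
  angle_fun (fun x => winding (fun r => s r - x) a b) (s @` `[a, b]) (s a) (s b).
Proof.
move=> ab cs x Kx.
have csx := cont_on_addr x cs.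
have sx : avoids (fun r => s r - x) a b.
  move=> c cab; rewrite subr_eq0; apply/eqP => cx; apply: Kx.
  by exists c => //=; rewrite in_itv.
have [d d0 hd] := avoids_lower ab csx sx.
have [e e0 he] := winding_near ab csx sx.
near=> z; split.
  move=> [c]; rewrite /= in_itv /= => cab cz.
  have := hd c cab; rewrite cz leNgt => /negP; apply.
  by near: z; exact: cvgr_distC_lt.
apply: he => [|c cab]; first exact: cont_on_addr.
have -> : s c - z - (s c - x) = x - z by rewrite opprB addrC addrA subrK.
by near: z; exact: cvgr_dist_lt.
Unshelve. all: by end_near. Qed.

Lemma angle_fun_cat (W W' : P -> R) K K' u v w :
  angle_fun W K u v -> angle_fun W' K' v w ->
  angle_fun (fun x => W x + W' x) (K `|` K') u w.
Proof.
move=> h h' x /not_orP[Kx Kx']; near=> z.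
have [zK e] : ~ K z /\ W z - W x = crossing (v - x) (v - z) - crossing (u - x) (u - z).
  by near: z; exact: h.
have [zK' e'] : ~ K' z /\
    W' z - W' x = crossing (w - x) (w - z) - crossing (v - x) (v - z).
  by near: z; exact: h'.
by split; [case | lra].
Unshelve. all: by end_near. Qed.

Lemma angle_funN (W : P -> R) K u v :
  angle_fun W K u v -> angle_fun (fun x => - W x) K v u.
Proof.
move=> h x Kx; near=> z.
have [zK e] : ~ K z /\ W z - W x = crossing (v - x) (v - z) - crossing (u - x) (u - z).
  by near: z; exact: h.
by split=> //; lra.
Unshelve. all: by end_near. Qed.

(** The second hypothesis says that the weighted chain has no boundary. Applied to
    [fun w => crossing (w - x) (w - z)], it cancels the endpoint terms of the increments. *)
Lemma angle_fun_cycle (I : finType) (A : {pred I}) (k : I -> R)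
    (W : I -> P -> R) (K : I -> set P) (u v : I -> P) :
  (forall i, i \in A -> angle_fun (W i) (K i) (u i) (v i)) ->
  (forall g : P -> R, \sum_(i in A) k i * (g (v i) - g (u i)) = 0) ->
  forall x, (forall i, i \in A -> ~ K i x) ->
  \forall z \near x, \sum_(i in A) k i * W i z = \sum_(i in A) k i * W i x.
Proof.
move=> hW cyc x Kx; near=> z.
have h i : i \in A -> W i z - W i x =
    crossing (v i - x) (v i - z) - crossing (u i - x) (u i - z).
  move=> iA; move: i iA; near: z.
  apply: filter_forall => i; have [iA|] := boolP (i \in A); last by move=> _; near=> z.
  by near=> z => _; have [] : ~ K i z /\ W i z - W i x =
    crossing (v i - x) (v i - z) - crossing (u i - x) (u i - z) by near: z; exact: hW iA x (Kx i iA).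
apply/eqP; rewrite -subr_eq0 -sumrB; apply/eqP.
rewrite -[RHS](cyc (fun w => crossing (w - x) (w - z))); apply: eq_bigr => i iA.
by rewrite -mulrBr h.
Unshelve. all: by end_near. Qed.

Definition clamp (x : R) : R := Num.max (-1) (Num.min 1 x).

(* The boundary of [[-1, 1]^2], counterclockwise from the corner (1, -1); the
   sides are traversed on the four quarters of [[0, 1]]. *)
Definition square (r : R) : P :=
  (clamp (`|8 * r - 5| - 2), clamp (2 - `|8 * r - 3|)).

Lemma clamp_le1 x : -1 <= clamp x <= 1.
Proof. rewrite /clamp /Num.max /Num.min; do 2 case: ifP; lra. Qed.

Lemma clamp_ge x : 1 <= x -> clamp x = 1.
Proof. by rewrite /clamp /Num.max /Num.min => ?; do 2 case: ifP; lra. Qed.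

Lemma clamp_le x : x <= -1 -> clamp x = -1.
Proof. by rewrite /clamp /Num.max /Num.min => ?; do 2 case: ifP; lra. Qed.

Lemma square_continuous : continuous square.
Proof.
move=> r.
have cabs (f : R -> R) : {for r, continuous f} ->
    {for r, continuous (fun q : R => `|f q|)}.
  by move=> cf; apply: (continuous_comp cf); exact: norm_continuous.
have cl (f : R -> R) : {for r, continuous f} ->
    {for r, continuous (fun q : R => clamp (f q))}.
  move=> cf; apply: continuous_max; first exact: cvg_cst.
  by apply: continuous_min => //; exact: cvg_cst.
have lin (k : R) : {for r, continuous (fun q : R => `|8 * q - k|)}.
  apply: cabs; apply: cvgB; last exact: cvg_cst.
  by apply: cvgM; [exact: cvg_cst|exact: cvg_id].
have c1 : {for r, continuous (fun q : R => clamp (`|8 * q - 5| - 2))}.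
  by apply: cl; apply: cvgB; [exact: lin|exact: cvg_cst].
have c2 : {for r, continuous (fun q : R => clamp (2 - `|8 * q - 3|))}.
  by apply: cl; apply: cvgB; [exact: cvg_cst|exact: lin].
exact: (cvg_pair c1 c2).
Qed.

Lemma norm_square r : `|square r| <= 1.
Proof.
rewrite norm_pairE /= ge_max !ler_norml.
by rewrite !clamp_le1.
Qed.

Lemma square_right r : 0 <= r <= 1/4 -> (square r).1 = 1.
Proof. by move=> ?; apply: clamp_ge; rewrite ler0_norm; lra. Qed.

Lemma square_top r : 1/4 <= r <= 1/2 -> (square r).2 = 1.
Proof.
by move=> ?; apply: clamp_ge; rewrite lerBrDl -lerBrDr ler_norml; lra.
Qed.

Lemma square_left r : 1/2 <= r <= 3/4 -> (square r).1 = -1.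
Proof. by move=> ?; apply: clamp_le; rewrite lerBlDr ler_norml; lra. Qed.

Lemma square_bottom r : 3/4 <= r <= 1 -> (square r).2 = -1.
Proof. by move=> ?; apply: clamp_le; rewrite ger0_norm; lra. Qed.

Lemma square0 : square 0 = (1, -1).
Proof.
congr (_, _); first by apply: square_right; lra.
by apply: clamp_le; rewrite ler0_norm; lra.
Qed.

Lemma square1 : square 1 = (1, -1).
Proof.
congr (_, _); last by apply: square_bottom; lra.
by apply: clamp_ge; rewrite ger0_norm; lra.
Qed.

Lemma norm_square1 r : 0 <= r <= 1 -> `|square r| = 1.
Proof.
move=> /andP[r0 r1]; apply/eqP; rewrite eq_le norm_square norm_pairE le_max.
have [h1|h1] := lerP r (1/4); first by rewrite square_right ?normr1 ?lexx //; lra.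
have [h2|h2] := lerP r (1/2).
  by rewrite square_top ?normr1 ?lexx ?orbT //; lra.
have [h3|h3] := lerP r (3/4).
  by rewrite square_left ?normrN1 ?lexx //; lra.
by rewrite square_bottom ?normrN1 ?lexx ?orbT //; lra.
Qed.

Lemma winding_square M u : `|u| < M ->
  winding (fun r => M *: square r - u) 0 1 = 1.
Proof.
move=> uM; have M0 : 0 < M by apply: le_lt_trans uM.
pose s r := M *: square r - u.
have s1 r : (s r).1 = M * (square r).1 - u.1 by [].
have s2 r : (s r).2 = M * (square r).2 - u.2 by [].
have cs : cont_on s 0 1.
  apply: continuous_cont_on => r; apply: cvgB; last exact: cvg_cst.
  by apply: cvgZl_tmp; exact: square_continuous.
have s0 : avoids s 0 1.
  move=> r r01; rewrite subr_eq0; apply/eqP => Mu.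
  by move: uM; rewrite -Mu normrZ norm_square1 // mulr1 gtr0_norm // ltxx.
have sub a b : 0 <= a -> b <= 1 -> cont_on s a b /\ avoids s a b.
  by move=> a0 b1; split; [exact: cont_on_sub cs|exact: avoids_sub s0].
have [||c1 v1] := sub 0 (1/4); try lra.
have [||c2 v2] := sub 0 (1/2); try lra.
have [||c3 v3] := sub 0 (3/4); try lra.
(* One piece for each side: seen from [u], only the right side crosses the right half-axis, once and
   upwards. *)
rewrite -/s -(@winding_cat _ s 0 (3/4) 1) //; try lra.
rewrite -(@winding_cat _ s 0 (1/2) (3/4)) //; try lra.
rewrite -(@winding_cat _ s 0 (1/4) (1/2)) //; try lra.
move: uM; rewrite norm_pair_lt !ltr_norml => /andP[/andP[u1 u1'] /andP[u2 u2']].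
rewrite [X in X + _ + _ + _]winding_right; [|lra|]; last first.
  by move=> c hc; rewrite s1 square_right // mulr1; lra.
rewrite [X in _ + X + _ + _](@winding_upper _ _ _ _ 1); [|lra|]; last first.
  move=> c hc; rewrite /upper s2 square_top // mulr1.
  by have -> : 0 <= M - u.2 by lra.
rewrite [X in _ + X + _](@winding_left _); [|lra|]; last first.
  by move=> c hc; rewrite s1 square_left //; lra.
rewrite [X in _ + X](@winding_upper _ _ _ _ 0); [|lra|]; last first.
  move=> c hc; rewrite /upper s2 square_bottom //.
  by rewrite leNgt; have -> : M * -1 - u.2 < 0 by lra.
rewrite !addr0 /upper !s2 square0 square_top /=; last lra.
have -> : 0 <= M * 1 - u.2 by lra.
have e2 : M * -1 - u.2 < 0 by lra.
by rewrite leNgt e2 subr0.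
Qed.

(** Scaling contracts the loop to the origin, and [r] has no zero on the way. The rotation is
    locally constant in the scaling factor, as the endpoint terms of [winding_near] cancel on a
    loop; at factor 0 the path is constant. *)
Lemma winding_extends (r : P -> P) s a b : continuous r ->
  (forall z, r z != 0) -> a <= b -> cont_on s a b -> s a = s b ->
  winding (r \o s) a b = 0.
Proof.
move=> cr r0 ab cs sab.
pose h q c := r (q *: s c).
have ch q : cont_on (h q) a b.
  apply: (@cont_on_comp _ (fun z => r (q *: z))) cs => z.
  apply: (@continuous_comp _ _ _ (fun z => q *: z) r); last exact: cr.
  by apply: cvgZl_tmp; exact: cvg_id.
have tube q e : 0 < e -> exists2 d, 0 < d & forall q', `|q' - q| < d ->
    forall c, a <= c <= b -> `|h q' c - h q c| < e.
  move=> e0.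
  apply: (@cousin _ (fun l m => exists2 d, 0 < d & forall q', `|q' - q| < d ->
    forall c, l <= c <= m -> `|h q' c - h q c| < e) a b ab) => [c cab|l c m _ _ _ _].
    have /cvgrPdist_lt /(_ (e / 2)) := cr (q *: s c).
    have e20 : 0 < e / 2 by rewrite divr_gt0.
    move=> /(_ e20) /nbhs_normP[d1 /= d10 hr].
    pose N := `|s c| + 1; pose Q := `|q| + 1.
    have N0 : 0 < N by rewrite ltr_wpDl.
    have Q0 : 0 < Q by rewrite ltr_wpDl.
    pose eta := Num.min 1 (d1 / 2 / Q).
    have eta0 : 0 < eta by rewrite lt_min ltr01 !divr_gt0.
    have [d d0 hs] := cs c cab eta eta0; exists d => //.
    move=> l m al lc cm mb dl md; exists (d1 / 2 / N); first by rewrite !divr_gt0.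
    have hr' q' c' : `|q' - q| < d1 / 2 / N -> l <= c' <= m ->
        `|h q' c' - h q c| < e / 2.
      move=> qq /andP[lc' cm'].
      have : `|s c' - s c| < eta.
        apply: hs; first by rewrite (le_trans al lc') (le_trans cm' mb).
        by rewrite ltr_norml; apply/andP; split; lra.
      rewrite lt_min => /andP[sc1 sc2].
      have sN : `|s c'| < N.
        by have := lerB_dist (s c') (s c); rewrite /N; lra.
      rewrite distrC; apply: hr => /=; rewrite distrC.
      have -> : q' *: s c' - q *: s c = (q' - q) *: s c' + q *: (s c' - s c).
        by rewrite scalerBl scalerBr addrA subrK.
      apply: (le_lt_trans (ler_normD _ _)); rewrite !normrZ.
      have i1 : `|q' - q| * `|s c'| <= d1 / 2.
        have -> : d1 / 2 = (d1 / 2 / N) * N by rewrite divfK // gt_eqF.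
        by apply: ler_pM => //; exact: ltW.
      have i2 : `|q| * `|s c' - s c| <= `|q| * (d1 / 2 / Q).
        by rewrite ler_wpM2l // ltW.
      have i3 : `|q| * (d1 / 2 / Q) < d1 / 2.
        have e3 : d1 / 2 = Q * (d1 / 2 / Q) by rewrite [RHS]mulrC divfK // gt_eqF.
        rewrite [X in _ < X]e3.
        by rewrite ltr_pM2r ?divr_gt0 // ltrDl.
      by lra.
    move=> q' qq c' lc'm.
    have h1 := hr' _ _ qq lc'm.
    have h2 : `|h q c' - h q c| < e / 2.
      by apply: hr' => //; rewrite subrr normr0 !divr_gt0.
    by have := ler_distD (h q c) (h q' c') (h q c'); rewrite (distrC (h q c)); lra.
  move=> [d d0 hd] [d' d'0 hd']; exists (Num.min d d'); first by rewrite lt_min d0.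
  move=> q'; rewrite lt_min => /andP[qd qd'] c' /andP[lc' c'm].
  have [cc|cc] := lerP c' c; first by apply: hd => //; rewrite lc'.
  by apply: hd' => //; rewrite c'm ltW.
have -> : r \o s = h 1 by apply/funext => c; rewrite /h scale1r.
rewrite -(@locally_constant_itv _ _ (fun q => winding (h q) a b) 0 1) //.
  by apply: (@winding_upper _ _ _ _ (upper (r 0))) => // c _; rewrite /h scale0r.
move=> q _.
have [e e0 he] : exists2 e, 0 < e & forall t, cont_on t a b ->
    (forall c, a <= c <= b -> `|t c - h q c| < e) ->
    winding t a b - winding (h q) a b =
      crossing (h q b) (t b) - crossing (h q a) (t a).
  by apply: winding_near => // c _; exact: r0.
have [d d0 hd] := tube q e e0; exists d => // q' _ qq.
have := he (h q') (ch q') (hd q' qq); rewrite /h sab subrr => /eqP.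
by rewrite subr_eq0 => /eqP.
Qed.

End Rotation.

(** * Simple closed curves *)

Section Arcs.
Set Implicit Arguments.
Unset Strict Implicit.
Unset Printing Implicit Defensive.
Variable R : realType.
Local Notation P := (R * R)%type.
Implicit Types (u v w z : P) (s t gam : R -> P) (a b c d e : R) (A E F : set P).

Lemma cont_on_within (s : R -> P) a b :
  cont_on s a b -> {within `[a, b], continuous s}.
Proof.
move=> cs; apply/subspace_continuousP => c /=; rewrite in_itv /= => cab.
apply/cvgrPdist_lt => e e0; have [d d0 H] := cs c cab e e0.
rewrite near_withinE; near=> r => /=; rewrite in_itv /= => rab.
rewrite distrC; apply: H => //; rewrite distrC.
Unshelve. all: by end_near. Qed.

(** A compact set of parameters has a closed image. With [K] the complement of an open interval,
    curve points near [z] can only have parameters in that interval. *)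
Lemma image_avoid_near s a b (K : set R) z : cont_on s a b -> closed K ->
  (forall r, a <= r <= b -> K r -> s r <> z) ->
  \forall w \near z, forall r, a <= r <= b -> K r -> s r <> w.
Proof.
move=> cs cK h.
have cc : closed (s @` (`[a, b] `&` K)).
  apply: compact_closed; first exact: norm_hausdorff.
  apply: continuous_compact.
    by apply: continuous_subspaceW (cont_on_within cs) => r [].
  by apply: compact_closedI => //; exact: segment_compact.
have := closed_openC cc; rewrite openE => /(_ z) H.
have : (~` (s @` (`[a, b] `&` K))) z.
  by move=> [r [/= rab Kr] srz]; apply: (h r) => //; rewrite in_itv in rab.
move/H; apply: filterS => w nw r rab Kr srw; apply: nw.
by exists r => //; split=> //=; rewrite in_itv.
Qed.

Lemma image_closed s a b : cont_on s a b -> closed (s @` `[a, b]).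
Proof.
move=> cs; rewrite -openC openE => z nz.
have := @image_avoid_near s a b setT z cs closedT.
case=> [r rab _ srz|e /= e0 H]; first by apply: nz; exists r; rewrite //= in_itv.
exists e => // w /H h [r /=]; rewrite in_itv => rab srw; exact: (h r).
Qed.

Lemma eq_winding s t a b : (forall c, a <= c <= b -> s c = t c) ->
  winding s a b = winding t a b.
Proof.
move=> st; rewrite /winding.
suff -> : is_lift s a b = is_lift t a b by [].
apply/funext => l; apply/propext; split=> h c cab; have [d d0 H] := h c cab;
  exists d => // r rab rd; first by rewrite -!st ?H.
by rewrite !st ?H.
Qed.

(** By compactness the parameter is continuous on the arc. Tietze's theorem extends it to the plane;
    truncating to [[a, b]] and applying [s] gives the retraction. *)
Lemma arc_retraction s a b : a <= b -> cont_on s a b ->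
  (forall c d, a <= c <= b -> a <= d <= b -> s c = s d -> c = d) ->
  exists r : P -> P, [/\ continuous r,
    forall z, (s @` `[a, b]) (r z) &
    forall z, (s @` `[a, b]) z -> r z = z].
Proof.
move=> ab cs inj.
pose A := s @` `[a, b].
pose f z : R^o := xget a [set c | a <= c <= b /\ s c = z].
have fs c : a <= c <= b -> f (s c) = c.
  move=> cab; rewrite /f; case: xgetP => [d _ [dab sd]|/(_ c)]; first exact: inj.
  by case.
have cA : closed A by exact: image_closed.
have cf : {within A, continuous f}.
  apply/subspace_continuousP => z [c /=]; rewrite in_itv /= => cab <-.
  rewrite /from_subspace fs //; apply/cvgrPdist_lt => e e0.
  have [||d /= d0 H] := @image_avoid_near s a b (~` ball c e) (s c) cs.
  - by apply: open_closedC; exact: ball_open.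
  - move=> r rab nr src; apply: nr; rewrite (inj _ _ rab cab src).
    exact: ballxx.
  exists d => // w /H h [r /=]; rewrite in_itv /= => rab srw.
  subst; rewrite fs //.
  have [//|nb] := pselect (ball c e r).
  by have := h r rab nb.
have M0 : 0 < `|a| + `|b| + 1 by rewrite ltr_wpDl // addr_ge0.
have fM z : A z -> `|f z| <= `|a| + `|b| + 1.
  move=> [c /=]; rewrite in_itv /= => cab <-; rewrite fs //.
  have := ler_norm b; have := ler_norm (- a); rewrite normrN.
  have := normr_ge0 a; have := normr_ge0 b.
  by rewrite ler_norml; lra.
have [g [fg cg _]] := continuous_bounded_extension pseudometric_normal cA M0 cf fM.
pose k (x : R) := Num.max a (Num.min b x).
have kab x : a <= k x <= b.
  by rewrite /k le_max lexx /= ge_max ab ge_min lexx.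
have kid x : a <= x <= b -> k x = x.
  by move=> /andP[ax xb]; rewrite /k min_r // max_r.
exists (fun z => s (k (g z))); split.
- move=> z; apply/cvgrPdist_lt => e e0.
  have [d d0 H] := cs _ (kab (g z)) e e0.
  have ck : {for z, continuous (fun w => k (g w) : R^o)}.
    apply: continuous_max; first exact: cvg_cst.
    by apply: continuous_min; [exact: cvg_cst|exact: cg].
  have /cvgrPdist_lt /(_ d d0) := ck; apply: filterS => w hw.
  by rewrite distrC; apply: H; rewrite // distrC.
- by move=> z; exists (k (g z)) => //=; rewrite in_itv /= kab.
- move=> z [c /=]; rewrite in_itv /= => cab <-.
  rewrite -fg; last by rewrite inE; exists c; rewrite //= in_itv.
  by rewrite fs // kid.
Qed.

(* Retracting [F] to the arc and fixing the rest of the plane would extend the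
   identity of a large square to a map omitting a point of [F]. *)
Lemma arc_not_frontier s a b F M : a <= b -> cont_on s a b ->
  (forall c d, a <= c <= b -> a <= d <= b -> s c = s d -> c = d) ->
  open F -> F !=set0 -> (forall z, F z -> `|z| < M) ->
  (forall z, F z -> ~ (s @` `[a, b]) z) ->
  ~ (closure F `<=` F `|` s @` `[a, b]).
Proof.
move=> ab cs inj oF [x0 Fx0] bF FA clF.
have [r [cr rA rid]] := arc_retraction ab cs inj.
pose k z := if pselect (F z) then r z else z.
have kF z : F z -> k z = r z by rewrite /k; case: pselect.
have knF z : ~ F z -> k z = z by rewrite /k; case: pselect.
have ck : continuous k.
  move=> z; apply/cvgrPdist_lt => e e0.
  have nr : \forall w \near z, `|r z - r w| < e.
    by move: (cr z) => /cvgrPdist_lt; apply.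
  have nz : \forall w \near z, `|z - w| < e by apply/nbhs_normP; exists e.
  have [Fz|Fz] := pselect (F z).
    have nF : \forall w \near z, F w by exact: open_nbhs_nbhs.
    by near=> w; rewrite !kF //; near: w.
  rewrite knF //.
  (* Frontier points of [F] lie on the arc, where [r] is the identity and both formulas for [k]
     agree. *)
  have [Az|Az] := pselect ((s @` `[a, b]) z).
    near=> w; have [Fw|Fw] := pselect (F w).
      by rewrite kF // -{1}(rid z) //; near: w.
    by rewrite knF //; near: w.
  have nF : \forall w \near z, ~ F w.
    have : (~` closure F) z by move=> /clF [].
    move: (@closed_closure _ F) => /closed_openC; rewrite openE => /(_ z) /[apply].
    by apply: filterS => w nc Fw; apply: nc; exact: subset_closure.
  by near=> w; rewrite knF; near: w.
(* [k] omits [x0], because [r] takes its values on the arc. So the rotation of [h] along a large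
   square is 0 by [winding_extends], but also 1, as [k] fixes that square. *)
pose h z := k z - x0.
have ch : continuous h by move=> z; apply: cvgB; [exact: ck|exact: cvg_cst].
have h0 z : h z != 0.
  rewrite /h subr_eq0; apply/eqP; have [Fz|Fz] := pselect (F z).
    by rewrite kF // => e; apply: (FA x0) => //; rewrite -e; exact: rA.
  by rewrite knF // => e; apply: Fz; rewrite e.
have M0 : `|x0| < M by exact: bF.
have := @winding_extends _ h (fun q => M *: square q) 0 1 ch h0 ler01.
rewrite square0 square1 => /(_ _ erefl) H.
have : winding (h \o (fun q => M *: square q)) 0 1 = 1.
  rewrite -[RHS](winding_square M0); apply: eq_winding => c c01 /=; rewrite /h knF //.
  move=> /bF; rewrite normrZ norm_square1 // mulr1.
  by rewrite gtr0_norm ?ltxx // (le_lt_trans _ M0).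
rewrite H; first by move/eqP; rewrite eq_sym oner_eq0.
apply: continuous_cont_on => q; apply: cvgZl_tmp; exact: square_continuous.
Unshelve. all: by end_near. Qed.

End Arcs.

(** * The index of a simple closed curve *)

Section CurveIndex.
Set Implicit Arguments.
Unset Strict Implicit.
Unset Printing Implicit Defensive.
Variable R : realType.
Local Notation P := (R * R)%type.
Implicit Types (u v w z : P) (s t gam : R -> P) (a b c d e : R) (A E F : set P).

Definition curve_index gam z : R := winding (fun r => gam r - z) 0 1.

Lemma simple_closed_cont gam : simple_closed_param gam -> cont_on gam 0 1.
Proof. by case=> /within_cont_on. Qed.

Lemma simple_closed_inj gam c d : simple_closed_param gam ->
  0 <= c < 1 -> 0 <= d < 1 -> gam c = gam d -> c = d.
Proof. by case=> _ _ inj hc hd; apply: inj; rewrite in_itv. Qed.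

Lemma trace_closed gam : simple_closed_param gam -> closed (trace gam).
Proof. by move=> /simple_closed_cont; exact: image_closed. Qed.

Lemma index_near gam x : simple_closed_param gam -> ~ trace gam x ->
  \forall z \near x, curve_index gam z = curve_index gam x.
Proof.
move=> sc; have := @path_angle_fun _ gam 0 1 ler01 (simple_closed_cont sc).
have [_ g01 _] := sc; rewrite g01 => /[apply]; apply: filterS => z [_ /eqP].
by rewrite subrr subr_eq0 => /eqP.
Qed.

Lemma index_connected gam A x y : simple_closed_param gam -> connected A ->
  (forall z, A z -> ~ trace gam z) -> A x -> A y -> curve_index gam x = curve_index gam y.
Proof.
move=> sc cA At; apply: connected_locally_constant => // z /At /(index_near sc).
by apply: filterS.
Qed.

(** A viewpoint outside a square containing the curve sees it in a half-plane, where a loop does not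
    turn. *)
Lemma index_far gam : simple_closed_param gam -> exists2 M, 0 <= M &
  forall x, M < `|x| -> ~ trace gam x /\ curve_index gam x = 0.
Proof.
move=> sc; have cg := simple_closed_cont sc.
have [M hM] : exists M, forall c, 0 <= c <= 1 -> `|gam c| <= M.
  apply: (@cousin _ (fun l r => exists M, forall c, l <= c <= r -> `|gam c| <= M)
    0 1 ler01) => [c c01|l c r _ _ _ _ [M hM] [N hN]].
    have [d d0 H] := cg c c01 1 ltr01; exists d => // l r ? ? ? ? ? ?.
    exists (`|gam c| + 1) => q /andP[lq qr].
    have : `|gam q - gam c| < 1.
      by apply: H; [lra|rewrite ltr_norml; lra].
    by have := lerB_dist (gam q) (gam c); lra.
  exists (Num.max M N) => q /andP[lq qr]; rewrite le_max.
  have [qc|cq] := lerP q c; first by rewrite hM // lq.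
  by rewrite hN ?orbT // qr ltW.
have M0 : 0 <= M by apply: le_trans (hM 0 _); rewrite ?normr_ge0 ?lexx ?ler01.
exists M => // x xM; split.
  move=> [c]; rewrite /= in_itv /= => c01 cx.
  by move: xM; rewrite -cx ltNge hM.
have g1 c : 0 <= c <= 1 -> - M <= (gam c).1 <= M.
  by move=> /hM; rewrite norm_pairE ge_max ler_norml => /andP[].
have g2 c : 0 <= c <= 1 -> - M <= (gam c).2 <= M.
  by move=> /hM; rewrite norm_pairE ge_max !ler_norml => /andP[].
move: xM; rewrite norm_pairE lt_max => /orP[]; rewrite lter_normr => /orP[] xM.
- by apply: winding_left => // c /g1 /=; lra.
- rewrite /curve_index winding_right //; first by have [_ -> _] := sc; rewrite subrr.
  by move=> c /g1 /=; lra.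
- apply: (@winding_upper _ _ _ _ 0) => // c /g2 /= ?; rewrite /upper /= leNgt.
  by have -> : (gam c).2 - x.2 < 0 by lra.
- apply: (@winding_upper _ _ _ _ 1) => // c /g2 /= ?; rewrite /upper /=.
  by have -> : 0 <= (gam c).2 - x.2 by lra.
Qed.

(* If the index vanished off the curve, the rotations of its two halves would
   be opposite there, and would glue to a function on the plane minus the two
   common endpoints [p], [q] varying like the angle of [pq]. Such a function
   cannot be single-valued around [p]. *)
Lemma exists_index_neq0 gam : simple_closed_param gam ->
  exists2 z, ~ trace gam z & curve_index gam z != 0.
Proof.
move=> sc; have cg := simple_closed_cont sc; have [_ g01 _] := sc.
apply: contrapT => nz.
have idx0 z : ~ trace gam z -> curve_index gam z = 0.
  by move=> nt; apply: contrapT => /eqP i0; apply: nz; exists z.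
have h01 : 0 <= 1/2 :> R by lra.
have h12 : 1/2 <= 1 :> R by lra.
have half01 : 0 <= (1/2 : R) < 1 by lra.
pose p := gam 0; pose q := gam (1/2).
pose W1 x := winding (fun r => gam r - x) 0 (1/2).
pose W2 x := winding (fun r => gam r - x) (1/2) 1.
pose A1 : set P := gam @` `[0, 1/2]; pose A2 : set P := gam @` `[1/2, 1].
have cg1 : cont_on gam 0 (1/2) by apply: cont_on_sub cg.
have cg2 : cont_on gam (1/2) 1 by apply: cont_on_sub cg.
have a1 : angle_fun W1 A1 p q by exact: path_angle_fun.
have a2 : angle_fun W2 A2 q p by rewrite /p g01; exact: path_angle_fun.
have W12 x : ~ A1 x -> ~ A2 x -> W1 x = - W2 x.
  move=> n1 n2; have nt : ~ trace gam x.
    move=> [c]; rewrite /= in_itv /= => /andP[c0 c1] cx.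
    have [h|h] := lerP c (1/2); first by apply: n1; exists c; rewrite //= in_itv /= c0.
    by apply: n2; exists c; rewrite //= in_itv /= c1 ltW.
  apply/eqP; rewrite -addr_eq0 -(idx0 x nt) /curve_index.
  rewrite -(@winding_cat _ _ 0 (1/2) 1) //; first exact: cont_on_addr.
  move=> c c01; rewrite subr_eq0; apply/eqP => cx; apply: nt.
  by exists c; rewrite //= in_itv.
(* The glued function: off both halves the two formulas agree, as the index is zero. *)
pose nu x := if pselect (A1 x) then - W2 x else W1 x.
have nu2 x : ~ A2 x -> nu x = - W2 x.
  by move=> n2; rewrite /nu; case: pselect => // n1; exact: W12.
have nu1 x : ~ A1 x -> nu x = W1 x by rewrite /nu; case: pselect.
have A12 x : x <> p -> x <> q -> ~ (A1 x /\ A2 x).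
  move=> xp xq [[c /= c1 cx] [d /= d1 dx]]; rewrite !in_itv /= in c1 d1.
  have [d11|d11] := eqVneq d 1; first by apply: xp; rewrite -dx d11 /p g01.
  have e : c = d.
    by apply: (simple_closed_inj sc); [lra|lra|rewrite cx dx].
  by apply: xq; rewrite -cx /q; congr gam; lra.
have nuE x : x <> p -> x <> q -> \forall z \near x,
    nu z - nu x = crossing (q - x) (q - z) - crossing (p - x) (p - z).
  move=> xp xq; have [n1|n1] := pselect (A1 x).
    have n2 : ~ A2 x by move=> ?; exact: (A12 x).
    have := angle_funN a2 n2; apply: filterS => z [z2 <-].
    by rewrite !nu2.
  by have := a1 x n1; apply: filterS => z [z1 <-]; rewrite !nu1.
have pq : 0 < `|q - p|.
  rewrite normr_gt0 subr_eq0; apply/eqP => e.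
  have := @simple_closed_inj gam (1/2) 0 sc half01 _ e.
  by rewrite lexx ltr01 => /(_ isT) /eqP; rewrite gt_eqF.
(* A quarter is below the third required by [crossing_add] for the vectors to [q] from the square of
   half-side [rho] about [p]. *)
pose rho := `|q - p| / 4.
have rho0 : 0 < rho by rewrite divr_gt0.
pose t (r : R) : P := rho *: square r - 0.
pose s r := p - t r.
have sub3 (x y z : P) : x - y - (x - z) = z - y.
  by rewrite opprD opprK addrACA subrr add0r addrC.
have nt r : 0 <= r <= 1 -> `|t r| = rho.
  by move=> r01; rewrite /t subr0 normrZ norm_square1 // mulr1 gtr0_norm.
have ct : cont_on t 0 1.
  apply: continuous_cont_on => r; apply: cvgB; last exact: cvg_cst.
  by apply: cvgZl_tmp; exact: square_continuous.
(* Along this square [nu] varies like the angle of [q] minus that of [p]; taking it from the angle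
   of [q] leaves a lift of [t]. Its end values coincide, although [t] turns once. *)
have lt : is_lift t 0 1 (fun r => crossing (q - s 0) (q - s r) - nu (s r)).
  move=> c c01.
  have sp : s c <> p.
    move=> /eqP; rewrite /s subr_eq -subr_eq0 opprD addNKr oppr_eq0.
    by rewrite -normr_eq0 nt // gt_eqF.
  have sq : s c <> q.
    move=> h; have : `|p - q| = rho by rewrite -h /s opprB addrC subrK nt.
    by rewrite distrC /rho => h'; move: pq; rewrite h'; lra.
  have /nbhs_normP[e /= e0 he] := nuE (s c) sp sq.
  have [d d0 hd] := ct c c01 e e0; exists d => // r r01 rd.
  have : nu (s r) - nu (s c) =
      crossing (q - s c) (q - s r) - crossing (p - s c) (p - s r).
    apply: he => /=; have -> : s c - s r = t r - t c.
      exact: sub3.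
    exact: hd.
  have tE r' : p - s r' = t r' by rewrite /s opprB addrC subrK.
  rewrite !tE.
  have near r' : 0 <= r' <= 1 -> 3 * `|(q - s r') - (q - p)| < `|q - p|.
    move=> r'01; have -> : q - s r' - (q - p) = t r'.
      by rewrite -tE; exact: sub3.
    by rewrite nt // /rho; lra.
  have := crossing_add (near 0 _) (near c c01) (near r r01).
  by rewrite lexx ler01 => /(_ isT); lra.
have := @winding_square R rho 0; rewrite normr0 => /(_ rho0).
rewrite -/t (windingE ler01 lt) /s /t square0 square1.
by rewrite subrr => /esym/eqP; rewrite oner_eq0.
Qed.

Lemma cont_on_cat s a c b : cont_on s a c -> cont_on s c b -> a <= c -> c <= b ->
  cont_on s a b.
Proof.
move=> h1 h2 ac cb q /andP[aq qb] e e0.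
have [qc|cq|qc] := ltgtP q c.
- have [|d d0 H] := h1 q _ e e0; first by rewrite aq ltW.
  exists (Num.min d (c - q)); first by rewrite lt_min d0 subr_gt0.
  move=> r /andP[ar rb]; rewrite lt_min => /andP[rd rq].
  by apply: H => //; rewrite ar; move: rq; rewrite ltr_norml; lra.
- have [|d d0 H] := h2 q _ e e0; first by rewrite qb ltW.
  exists (Num.min d (q - c)); first by rewrite lt_min d0 subr_gt0.
  move=> r /andP[ar rb]; rewrite lt_min => /andP[rd rq].
  by apply: H => //; rewrite rb; move: rq; rewrite ltr_norml; lra.
- subst q; have [|d d0 H] := h1 c _ e e0; first by rewrite ac lexx.
  have [|d' d'0 H'] := h2 c _ e e0; first by rewrite cb lexx.
  exists (Num.min d d'); first by rewrite lt_min d0.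
  move=> r /andP[ar rb]; rewrite lt_min => /andP[rd rd'].
  have [rc|cr] := lerP r c; first by apply: H => //; rewrite ar.
  by apply: H' => //; rewrite rb ltW.
Qed.

End CurveIndex.

(** * The sides of a simple closed curve *)

Section Sides.
Set Implicit Arguments.
Unset Strict Implicit.
Unset Printing Implicit Defensive.
Variable R : realType.
Local Notation P := (R * R)%type.
Implicit Types (u v w z : P) (s t gam : R -> P) (a b c d e : R) (A E F : set P).

(** If a point of the curve were outside the closure of [E], cutting out a piece around it would
    leave an arc containing the frontier of [E]. This contradicts [arc_not_frontier], for [E] if it
    is bounded, else for the complement of the arc and the closure of [E]. *)
Lemma component_frontier gam E M : simple_closed_param gam -> open E ->
  E !=set0 -> (forall z, E z -> ~ trace gam z) ->
  closure E `<=` E `|` trace gam ->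
  (forall z, E z -> `|z| < M) \/ (forall z, ~ E z -> `|z| < M) ->
  trace gam `<=` closure E.
Proof.
move=> sc oE E0 Et clE bE z0 tz0; apply: contrapT => nz0.
have cg := simple_closed_cont sc; have [_ g01 _] := sc.
have [t0 /andP[t00 t01] gt0] : exists2 t0, 0 <= t0 < 1 & gam t0 = z0.
  case: tz0 => c; rewrite /= in_itv /= => /andP[c0]; rewrite le_eqVlt.
  by move=> /orP[/eqP ->|c1] <-; [exists 0; rewrite ?lexx ?ltr01 //|exists c; rewrite ?c0].
(* The curve is run through twice, so that it can be cut open at [t0]. *)
pose s r := if r <= 1 then gam r else gam (r - 1).
have cs : cont_on s 0 2.
  apply: (@cont_on_cat _ _ _ 1); rewrite ?ler01 //; last lra.
    move=> c c01 e e0; have [d d0 H] := cg c c01 e e0; exists d => // r r01 rd.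
    by rewrite /s; case/andP: c01 => _ ->; case/andP: (r01) => _ ->; exact: H.
  have s1 r : 1 <= r -> s r = gam (r - 1).
    rewrite le_eqVlt /s => /orP[/eqP <-|r1]; first by rewrite lexx subrr g01.
    by rewrite leNgt r1.
  move=> c /andP[c1 c2] e e0; have [|d d0 H] := cg (c - 1) _ e e0.
    by apply/andP; split; lra.
  exists d => // r /andP[r1 r2] rd; rewrite !s1 //; apply: H.
    by apply/andP; split; lra.
  by have -> : r - 1 - (c - 1) = r - c by ring.
have sE r : 0 <= r < 2 ->
    exists r', [/\ 0 <= r' < 1, s r = gam r' & r' = r \/ r' = r - 1].
  move=> /andP[r0 r2]; rewrite /s; have [r1|r1|->] := ltgtP r 1.
  - by exists r; split; [rewrite r0|by []|left].
  - by exists (r - 1); split; [apply/andP; split; lra|by []|right].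
  - by exists 0; split; [rewrite lexx ltr01|by rewrite g01|right; rewrite subrr].
have injs c d : 0 <= c < 2 -> 0 <= d < 2 -> `|c - d| < 1 -> s c = s d -> c = d.
  move=> /sE[c' [c01 -> cc]] /sE[d' [d01 -> dd]].
  rewrite ltr_norml => cd /(simple_closed_inj sc) => /(_ c01 d01) e.
  by case: cc; case: dd => ? ?; lra.
have trs r : 0 <= r <= 2 -> trace gam (s r).
  move=> r02; rewrite /s; case: ifPn => [r1|].
    by exists r => //=; rewrite in_itv /=; move: r02; lra.
  by rewrite -ltNge => r1; exists (r - 1) => //=; rewrite in_itv /=; lra.
have st0 : s t0 = z0 by rewrite /s ltW.
have st1 : s (t0 + 1) = z0.
  rewrite /s; case: ifPn; last by rewrite addrK.
  move=> h; have t00' : t0 = 0 by lra.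
  by rewrite -gt0 t00' add0r g01.
have [e e0 nE] : exists2 e, 0 < e & forall z, `|z - z0| < e -> ~ closure E z.
  have := closed_openC (@closed_closure _ E); rewrite openE => /(_ z0 nz0).
  move=> /nbhs_normP[e /= e0 he]; exists e => // z; rewrite distrC; exact: he.
have t0int : 0 <= t0 <= 2 by apply/andP; split; lra.
have t1int : 0 <= t0 + 1 <= 2 by apply/andP; split; lra.
have [d1 d10 h1] := cs t0 t0int e e0.
have [d2 d20 h2] := cs (t0 + 1) t1int e e0.
(* The bound 1/4 ensures [a <= b]; [d1] and [d2] keep the removed ends within [e] of [z0]. *)
pose eta := Num.min (1/4) (Num.min d1 d2).
have eta0 : 0 < eta by rewrite !lt_min d10 d20 divr_gt0.
have eta1 : eta <= 1/4 by rewrite ge_min lexx.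
have etad1 : eta <= d1 by rewrite !ge_min lexx orbT.
have etad2 : eta <= d2 by rewrite !ge_min lexx !orbT.
pose a := t0 + eta; pose b := t0 + 1 - eta.
have ab : a <= b by rewrite /a /b; lra.
have a0 : 0 <= a by rewrite /a; lra.
have b2 : b < 2 by rewrite /b; lra.
have ba1 : b - a < 1 by rewrite /a /b; lra.
pose A := s @` `[a, b].
have AT z : A z -> trace gam z.
  by move=> [r]; rewrite /= in_itv /= => rab <-; apply: trs; lra.
have TA z : trace gam z -> A z \/ `|z - z0| < e.
  move=> tz.
  have [r r01 <-] : exists2 r, t0 <= r <= t0 + 1 & s r = z.
    have [c /andP[c0 c1] <-] : exists2 c, 0 <= c < 1 & gam c = z.
      case: tz => c; rewrite /= in_itv /= => /andP[c0]; rewrite le_eqVlt.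
      move=> /orP[/eqP ->|c1] <-; last by exists c; rewrite ?c0.
      by exists 0; rewrite ?lexx ?ltr01.
    have [tc|ct] := lerP t0 c.
      by exists c; [apply/andP; split; lra|rewrite /s ltW].
    exists (c + 1); first by apply/andP; split; lra.
    rewrite /s; case: ifPn => [h|]; last by rewrite addrK.
    by have c00 : c = 0 by [lra|]; rewrite c00 add0r g01.
  have [ra|ar] := ltrP r a.
    by right; rewrite -st0; apply: h1; rewrite ?ltr_norml; apply/andP; split;
      move: ra; rewrite /a; lra.
  have [br|rb] := ltrP b r.
    by right; rewrite -st1; apply: h2; rewrite ?ltr_norml; apply/andP; split;
      move: br; rewrite /b; lra.
  by left; exists r => //=; rewrite in_itv /= ar.
have nA : ~ A z0.
  move=> [r]; rewrite /= in_itv /= -st0 => rab /injs h.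
  have : r = t0.
    by apply: h; rewrite ?ltr_norml; apply/andP; split; move: rab; rewrite /a /b; lra.
  by move: rab; rewrite /a; lra.
have clEA : closure E `<=` E `|` A.
  move=> y cy; have [Ey|/TA[Ay|]] := clE _ cy; [by left|by right|].
  by move=> /nE.
have csab : cont_on s a b by apply: cont_on_sub cs => //; exact: ltW.
have injab c d : a <= c <= b -> a <= d <= b -> s c = s d -> c = d.
  move=> hc hd; apply: injs; rewrite ?ltr_norml; apply/andP; split;
    move: hc hd; lra.
have clA : closed A by exact: image_closed.
case: bE => bE.
  apply: (arc_not_frontier ab csab injab oE E0 bE _ clEA) => z Ez Az.
  by apply: (Et z) => //; exact: AT.
pose F := ~` closure E `&` ~` A.
have oF : open F.
  by apply: openI; apply: closed_openC => //; exact: closed_closure.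
have F0 : F !=set0 by exists z0.
have bF z : F z -> `|z| < M.
  by move=> [nEz _]; apply: bE => Ez; apply: nEz; exact: subset_closure.
apply: (arc_not_frontier ab csab injab oF F0 bF) => [z []//|y cy].
have [Ay|nAy] := pselect (A y); [by right|left; split=> //].
move=> /clEA[Ey|//]; have [w [[nEw _] Ew]] := cy E (open_nbhs_nbhs (conj oE Ey)).
by apply: nEw; exact: subset_closure.
Qed.

(** In the sup norm this is a union of four half-planes, each meeting the next in a quadrant. *)
Lemma connected_far M : 0 <= M -> connected [set z : P | M < `|z|].
Proof.
move=> M0.
have half (l : P -> R) : (forall u v r, l (segment u v r) = (1 - r) * l u + r * l v) ->
    connected [set z | M < l z].
  move=> hl; apply: convex_connected => u v /= Mu Mv r /andP[r0 r1].
  rewrite hl; have [->|r1'] := eqVneq r 1; first by lra.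
  have {r1'} r1' : 0 < 1 - r by rewrite subr_gt0 lt_neqAle r1'.
  have : (1 - r) * M < (1 - r) * l u by rewrite ltr_pM2l.
  by have : r * M <= r * l v by [rewrite ler_wpM2l // ltW|]; lra.
have -> : [set z : P | M < `|z|] = [set z | M < z.1] `|` [set z | M < z.2] `|`
    [set z | M < - z.1] `|` [set z | M < - z.2].
  apply/seteqP; split=> z /=; rewrite norm_pairE lt_max !lter_normr.
    by move=> /orP[] /orP[] ?; [left; left; left|left; right|left; left; right|right].
  by move=> [[[]|]|] ->; rewrite ?orbT.
apply: connectedU; first by exists (- (M + 1), - (M + 1)); split => /=; [right|]; lra.
  apply: connectedU; first by exists (- (M + 1), M + 1); split => /=; [right|]; lra.
    apply: connectedU; first by exists (M + 1, M + 1); split => /=; lra.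
      by apply: half => u v r; rewrite /segment /= /GRing.scale /=; ring.
    by apply: half => u v r; rewrite /segment /= /GRing.scale /=; ring.
  by apply: (half (fun z => - z.1)) => u v r; rewrite /segment /= /GRing.scale /=; ring.
by apply: (half (fun z => - z.2)) => u v r; rewrite /segment /= /GRing.scale /=; ring.
Qed.

Lemma component_closure A z : closed A ->
  closure (connected_component (~` A) z) `<=`
  connected_component (~` A) z `|` A.
Proof.
move=> cA y cy; have [Ay|nAy] := pselect (A y); [by right|left].
have oA : open (connected_component (~` A) y).
  by apply: component_open; exact: closed_openC.
have [|w [zw yw]] := cy (connected_component (~` A) y).
  by apply: open_nbhs_nbhs; split => //; exact: connected_component_refl.
exact: connected_component_trans zw (connected_component_sym yw).
Qed.

(* The side of the curve not containing [x], which is all that is needed of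
   the Jordan curve theorem. *)
Lemma other_side gam x : simple_closed_param gam -> ~ trace gam x ->
  exists E (k : R), [/\ connected E, open E, forall z, E z -> ~ trace gam z,
    trace gam `<=` closure E & k != 0 /\
    forall z, E z -> curve_index gam z - curve_index gam x = k].
Proof.
move=> sc nx; have [M M0 far] := index_far sc.
have cT := trace_closed sc.
have comp z : ~ trace gam z ->
    (forall w, connected_component (~` trace gam) z w -> `|w| < M + 1) \/
    (forall w, ~ connected_component (~` trace gam) z w -> `|w| < M + 1) ->
    curve_index gam z - curve_index gam x != 0 ->
  exists E (k : R), [/\ connected E, open E, forall z, E z -> ~ trace gam z,
    trace gam `<=` closure E & k != 0 /\
    forall z, E z -> curve_index gam z - curve_index gam x = k].
  move=> nz bz kz; pose E := connected_component (~` trace gam) z.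
  have Ez : E z by exact: connected_component_refl.
  have ET w : E w -> ~ trace gam w by exact: connected_component_sub.
  have oE : open E by apply: component_open; exact: closed_openC.
  exists E, (curve_index gam z - curve_index gam x); split=> //.
  - exact: component_connected.
  - apply: (component_frontier sc oE _ ET _ bz); first by exists z.
    exact: component_closure.
  - split=> // w Ew; congr (_ - _).
    by apply: (index_connected sc _ ET) => //; exact: component_connected.
have [ix|ix] := eqVneq (curve_index gam x) 0.
  (* The component of a point of nonzero index is bounded, since the index vanishes far away. *)
  have [z nz iz] := exists_index_neq0 sc.
  apply: (comp z nz); last by rewrite ix subr0.
  left => w Ew; rewrite ltNge; apply/negP => Mw.
  have [|_ iw] := far w; first by lra.
  suff e : curve_index gam z = curve_index gam w by move: iz; rewrite e iw eqxx.
  apply: (index_connected sc (component_connected (A := ~` trace gam) (x := z))) => //.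
    exact: connected_component_sub.
  exact: connected_component_refl.
(* Now [x] has nonzero index, and the component of a far point serves: its index is 0 and its
   complement is bounded. *)
pose z : P := (M + 1, 0).
have Mz : M < `|z| by rewrite norm_pairE /= lt_max lter_normr; apply/orP; left; lra.
have [nz iz] := far z Mz.
apply: (comp z nz); last by rewrite iz sub0r oppr_eq0.
right=> w nw; rewrite ltNge; apply/negP => Mw; apply: nw.
apply: (connected_component_max (B := [set z | M < `|z|])) => //=; last by lra.
  by move=> w' /far[].
exact: connected_far.
Qed.

End Sides.

(** * Paths in open sets *)

Section PlanePaths.
Set Implicit Arguments.
Unset Strict Implicit.
Unset Printing Implicit Defensive.
Variable R : realType.
Local Notation P := (R * R)%type.
Implicit Types (u v w z : P) (a b c d e : R) (D K Omega : set P).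

Lemma segment0 u v : segment u v 0 = u.
Proof. by rewrite /segment scale0r addr0. Qed.

Lemma segment1 u v : segment u v 1 = v.
Proof. by rewrite /segment scale1r addrC subrK. Qed.

Lemma segment_angle_fun u v :
  exists W, angle_fun W (segment u v @` `[0, 1]) u v.
Proof.
have := @path_angle_fun _ (segment u v) 0 1 ler01.
rewrite segment0 segment1 => H; eexists; apply: H.
exact/continuous_cont_on/segment_continuous.
Qed.

Lemma angle_fun_const u : angle_fun (fun=> 0) set0 u u.
Proof. by move=> x _; near=> z; split => //; rewrite !subrr. Unshelve. all: by end_near. Qed.

(** The points reachable by segments inside balls form an open and closed subset of [D]. Only a
    rotation function and its support are recorded, not a path. *)
Lemma connected_open_angle_fun D u v : open D -> connected D -> D u -> D v ->
  exists W K, K `<=` D /\ angle_fun W K u v.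
Proof.
move=> oD cD Du Dv.
pose reach w := exists W K, K `<=` D /\ angle_fun W K u w.
have step w z e : 0 < e -> ball w e `<=` D -> ball w e z -> reach w -> reach z.
  move=> e0 eD wz [W [K [KD aW]]]; have [W' aW'] := segment_angle_fun w z.
  eexists; eexists; split; last exact: (angle_fun_cat aW aW').
  rewrite subUset; split=> // t [r /=]; rewrite in_itv /= => r01 <-.
  by apply: eD; apply: ball_segment => //; exact: ballxx.
have back w z e : 0 < e -> ball w e `<=` D -> ball w e z -> reach z -> reach w.
  move=> e0 eD wz [W [K [KD aW]]]; have [W' aW'] := segment_angle_fun z w.
  eexists; eexists; split; last exact: (angle_fun_cat aW aW').
  rewrite subUset; split=> // t [r /=]; rewrite in_itv /= => r01 <-.
  by apply: eD; apply: ball_segment => //; exact: ballxx.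
have ru : reach u by exists (fun=> 0), set0; split=> //; exact: angle_fun_const.
suff e : reach v = reach u by have : reach v by rewrite e.
apply: (connected_locally_constant cD) => // w Dw.
move: oD; rewrite openE => /(_ w Dw) /nbhs_ballP[e /= e0 eD].
apply/nbhs_ballP; exists e => // z wz _; apply/propext; split.
  exact: (back w z e).
exact: (step w z e).
Qed.

(** The point [p] itself may be inaccessible. A segment from a nearby point of [Omega] towards [p]
    is followed up to its first point outside [Omega], which is [q]. *)
Lemma accessible_near Omega p e : open Omega -> closure Omega p ->
  ~ Omega p -> 0 < e ->
  exists x q, [/\ Omega x, closure Omega q, ~ Omega q, `|q - p| < e &
    forall r, 0 <= r < 1 -> Omega (segment x q r) /\ `|segment x q r - p| < e].
Proof.
move=> oO cp np e0.
have [|x [Ox px]] := cp (ball p e); first exact: nbhsx_ballx.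
pose T := [set r : R | 0 <= r <= 1 /\ ~ Omega (segment x p r)].
have T1 : T 1 by split; rewrite ?ler01 ?lexx // segment1.
have lT : has_lbound T by exists 0 => r [/andP[]].
pose r0 := inf T; pose q := segment x p r0.
have r01 : r0 <= 1 by exact: (ge_inf lT).
have r00 : 0 <= r0 by apply: lb_le_inf; [exists 1|move=> r [/andP[]]].
have below r : 0 <= r -> r < r0 -> Omega (segment x p r).
  move=> r1 r2; apply: contrapT => nO.
  suff : r0 <= r by rewrite leNgt r2.
  apply: (ge_inf lT); split=> //.
  by rewrite r1 (le_trans (ltW r2)).
have nq : ~ Omega q.
  move=> Oq; move: oO; rewrite openE => /(_ q Oq) nb.
  have /nbhs_normP[d /= d0 hd] := segment_continuous nb.
  have [|r [r1 nr] rd] := inf_adherent d0 (E := T); first by split; [exists 1|].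
  have r0r : r0 <= r by exact: (ge_inf lT (conj r1 nr)).
  apply: nr; apply: hd => /=; rewrite ler0_norm ?subr_le0 // opprB.
  by rewrite ltrBlDl.
have r0pos : 0 < r0.
  rewrite lt_neqAle r00 andbT; apply/eqP => r0E; apply: nq.
  by rewrite /q -r0E segment0.
have seg r : segment x q r = segment x p (r * r0).
  by rewrite /q /segment addrAC subrr add0r scalerA.
have inO r : 0 <= r < 1 -> Omega (segment x q r).
  move=> /andP[r1 r2]; rewrite seg; apply: below; first exact: mulr_ge0.
  by rewrite gtr_pMl.
have inB r : 0 <= r <= 1 -> `|segment x p r - p| < e.
  move=> r1; have : ball p e (segment x p r).
    by apply: ball_segment => //; exact: ballxx.
  by rewrite -ball_normE /= distrC.
exists x, q; split=> //; last 2 first.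
- by apply: inB; rewrite r00.
- move=> r r1; split; first exact: inO.
  by rewrite seg; apply: inB; case/andP: r1 => ? ?;
    rewrite mulr_ge0 //= mulr_ile1 // ltW.
move=> B nB.
have : \forall r \near (1 : R), B (segment x q r).
  by apply: segment_continuous; rewrite segment1.
move=> /nbhs_normP[d /= d0 hd].
pose r := Num.max 0 (1 - d / 2).
have rr : 0 <= r < 1 by rewrite /r le_max lexx gt_max ltr01; lra.
exists (segment x q r); split; first exact: inO.
apply: hd => /=; case/andP: rr => _ rr; rewrite gtr0_norm ?subr_gt0 //.
have : 1 - d / 2 <= r by rewrite /r le_max lexx orbT.
lra.
Qed.

End PlanePaths.

(** * Nodal domains and sign changes *)

Section Nodal.
Set Implicit Arguments.
Unset Strict Implicit.
Unset Printing Implicit Defensive.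
Variable R : realType.
Local Notation P := (R * R)%type.
Variables (Omega : set P) (g : nat) (gam : 'I_g.+1 -> R -> P) (f : P -> R).
Hypothesis domO : domain Omega.
Hypothesis sc : forall i, simple_closed_param (gam i).
Hypothesis comp : forall i, components (plane_boundary Omega) (trace (gam i)).
Hypothesis gam_inj : forall i j, trace (gam i) = trace (gam j) -> i = j.
Hypothesis bndE : plane_boundary Omega = \bigcup_i trace (gam i).
Hypothesis cf : {within closure Omega, continuous f}.
Implicit Types (x y z p q : P) (D : set P) (i j : 'I_g.+1).

Let oO : open Omega. Proof. by case: domO. Qed.

Lemma trace_boundary i z : trace (gam i) z -> closure Omega z /\ ~ Omega z.
Proof.
move=> tz; have : plane_boundary Omega z by rewrite bndE; exists i.
by rewrite /plane_boundary; move/interior_id: oO => ->.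
Qed.

Lemma boundary_trace z : closure Omega z -> ~ Omega z ->
  exists i, trace (gam i) z.
Proof.
move=> cz nz; have : plane_boundary Omega z.
  by rewrite /plane_boundary; move/interior_id: oO => ->.
by rewrite bndE => -[i _ tz]; exists i.
Qed.

Lemma trace_disjoint i j z : trace (gam i) z -> trace (gam j) z -> i = j.
Proof.
move=> ti tj; apply: gam_inj.
have [x _ ex] := comp i; have [y _ ey] := comp j.
rewrite -ex -ey; rewrite -ex in ti; rewrite -ey in tj.
by rewrite (same_connected_component ti) (same_connected_component tj).
Qed.

Lemma sign_near p : closure Omega p -> f p != 0 ->
  \forall z \near p, closure Omega z -> 0 < f z * f p.
Proof.
move=> cp fp; move/subspace_continuousP: cf => /(_ p cp).
have f0 : 0 < `|f p| by rewrite normr_gt0.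
move=> /cvgrPdist_lt /(_ _ f0); rewrite near_withinE; apply: filterS => z h cz.
move: (h cz); rewrite /from_subspace; have [fp0|fp0|/eqP] := ltgtP (f p) 0.
- by rewrite nmulr_lgt0 // (ltr0_norm fp0) ltr_norml; lra.
- by rewrite pmulr_lgt0 // (gtr0_norm fp0) ltr_norml; lra.
- by rewrite (negbTE fp).
Qed.

Let N := Omega `\` closure [set z | Omega z /\ f z = 0].

(** By continuity the zero set is closed in [Omega], so its closure adds no point of [Omega]. *)
Lemma nodal_setP z : N z <-> Omega z /\ f z != 0.
Proof.
split=> [[Oz nz]|[Oz fz]].
  by split=> //; apply/eqP => fz; apply: nz; exact: subset_closure.
split=> // cz; have [w [[Ow fw] h]] := cz _ (sign_near (subset_closure Oz) fz).
by move: (h (subset_closure Ow)); rewrite fw mul0r ltxx.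
Qed.

Lemma nodal_set_open : open N.
Proof. by apply: openI => //; apply: closed_openC; exact: closed_closure. Qed.

Lemma nodal_component x : Omega x -> f x != 0 ->
  nodal_domains f Omega (connected_component N x).
Proof. by move=> Ox fx; exists x => //; apply/nodal_setP. Qed.

Section Domain.
Variable D : set P.
Hypothesis nD : nodal_domains f Omega D.

Lemma nodal_open : open D.
Proof. by have [x _ <-] := nD; apply: component_open; exact: nodal_set_open. Qed.

Lemma nodal_connected : connected D.
Proof. by have [x _ <-] := nD; exact: component_connected. Qed.

Lemma nodal_sub z : D z -> Omega z /\ f z != 0.
Proof. by have [x _ <-] := nD => /connected_component_sub /nodal_setP. Qed.

Lemma nodal_nonempty : D !=set0.
Proof. by have [x Nx <-] := nD; exists x; exact: connected_component_refl. Qed.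

Lemma nodal_max z (A : set P) : D z -> A z -> connected A ->
  (forall w, A w -> Omega w /\ f w != 0) -> A `<=` D.
Proof.
have [x Nx <-] := nD; move=> xz Az cA AN.
rewrite (same_connected_component xz); apply: connected_component_max => //.
by move=> w /AN /nodal_setP.
Qed.

Lemma nodal_sign x y : D x -> D y -> (0 < f x) = (0 < f y).
Proof.
apply: (connected_locally_constant (g := fun z => 0 < f z) nodal_connected) => z Dz.
have [Oz fz] := nodal_sub Dz.
have := sign_near (subset_closure Oz) fz; apply: filterS => w h Dw.
have := h (subset_closure (nodal_sub Dw).1); have [fz0|fz0|/eqP] := ltgtP (f z) 0.
- by rewrite nmulr_lgt0 // => ?; apply/negbTE; rewrite -leNgt ltW.
- by rewrite pmulr_lgt0.
- by rewrite (negbTE fz).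
Qed.

End Domain.

(* A boundary point where [f] is positive can be moved along its curve to one
   reached by a path whose interior stays in a single nodal domain. *)
Lemma attach i (t lo hi : R) : 0 <= lo -> lo < t -> t < hi -> hi <= 1 ->
  0 < f (gam i t) ->
  exists T x W (K : set P),
    [/\ lo < T < hi, Omega x, 0 < f x, angle_fun W K x (gam i T) &
     forall D, nodal_domains f Omega D -> D x ->
       K `<=` D `|` [set gam i T]].
Proof.
move=> lo0 lot thi hi1 fp; pose p := gam i t.
have cg := simple_closed_cont (sc i); have [_ g01 _] := sc i.
have tp : trace (gam i) p.
  by exists t => //=; rewrite in_itv /=; apply/andP; split; lra.
have [cp nOp] := trace_boundary tp.
have fp0 : f p != 0 by rewrite gt_eqF.
have nf := sign_near cp fp0.
have nT : \forall z \near p, forall j, j != i -> ~ trace (gam j) z.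
  suff H j : \forall z \near p, j != i -> ~ trace (gam j) z.
    exact: (@filter_forall P _ (fun j z => j != i -> ~ trace (gam j) z) _ _ H).
  have [->|ji] := eqVneq j i; first by near=> z.
  have : (~` trace (gam j)) p.
    by move=> tj; move/eqP: ji; apply; exact: trace_disjoint tj tp.
  move: (closed_openC (trace_closed (sc j))); rewrite openE => /(_ p) /[apply].
  exact: filterS.
have nt : \forall z \near p, forall r, 0 <= r <= 1 -> (~` `]lo, hi[) r ->
    gam i r <> z.
  apply: image_avoid_near => //.
    by apply: open_closedC; exact: interval_open.
  move=> r /andP[r0 r1] nr rt; apply: nr; rewrite /= in_itv /=.
  suff <- : t = r by rewrite lot.
  have tt : 0 <= t < 1 by apply/andP; split; lra.
  (* Injectivity holds on [[0, 1[] only, so the parameter 1 is traded for 0. *)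
  have [r11|rn1] := eqVneq r 1.
    have := @simple_closed_inj _ _ t 0 (sc i) tt; rewrite lexx ltr01.
    by rewrite -/p -rt r11 g01 => /(_ isT erefl); lra.
  by apply: (simple_closed_inj (sc i) tt) => //; rewrite r0 lt_neqAle rn1.
have [e /= e0 he] := iffLR (nbhs_normP _ _) (filterI nf (filterI nT nt)).
have {he} he z : `|z - p| < e -> [/\ closure Omega z -> 0 < f z,
    forall j, trace (gam j) z -> j = i &
    forall r, 0 <= r <= 1 -> gam i r = z -> lo < r < hi].
  move=> zp; have [|h1 [h2 h3]] := he z; first by rewrite /= distrC.
  split.
  - by move=> /h1; rewrite pmulr_lgt0.
  - by move=> j tj; apply/eqP/negPn/negP => ji; exact: (h2 j ji).
  - by move=> r r01 rz; apply: contrapT => h; apply: (h3 r r01) rz; rewrite /= in_itv.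
(* The accessible point [q] replaces [p]; being close to [p], it lies on the same curve with
   parameter between [lo] and [hi]. *)
have [x [q [Ox cq nq qp seg]]] := accessible_near oO cp nOp e0.
have [j tj] := boundary_trace cq nq.
have [hq1 hq2 hq3] := he q qp.
have ji := hq2 j tj; subst j; case: tj => T; rewrite /= in_itv /= => T01 Tq.
have segf r : 0 <= r < 1 -> Omega (segment x q r) /\ 0 < f (segment x q r).
  move=> /seg[h1 /he[h2 _ _]]; split=> //; apply: h2; exact: subset_closure.
have [W aW] := segment_angle_fun x q.
exists T, x, W, (segment x q @` `[0, 1]); split.
- exact: (hq3 T T01 Tq).
- by [].
- by have := segf 0; rewrite segment0 lexx ltr01 => /(_ isT)[].
- by rewrite Tq.
move=> D nD Dx w [r /=]; rewrite in_itv /= => /andP[r0 r1] <-.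
have [->|rn1] := eqVneq r 1; first by right; rewrite segment1.
left; apply: (nodal_max nD Dx (A := segment x q @` `[0, 1[)).
- by exists 0; rewrite /= ?in_itv /= ?lexx ?ltr01 // segment0.
- apply: connected_continuous_connected.
    by apply/connected_intervalP; exact: interval_is_interval.
  exact/continuous_subspaceT/segment_continuous.
- move=> w' [r' /=]; rewrite in_itv /= => /segf[h1 h2] <-.
  by split=> //; rewrite gt_eqF.
- by exists r => //=; rewrite in_itv /= r0 lt_neqAle rn1.
Unshelve. all: by end_near. Qed.

(** Only the first parameter can be 0. It is pushed forward, short of the next one and within reach
    of the continuity of [f], so that no sign point is the origin of the curve. *)
Lemma sign_changes_interior i m : has_sign_changes f (gam i) m ->
  exists t : nat -> R,
    [/\ forall k, (k < m)%N -> 0 < t k < 1,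
        forall k l, (k < l)%N -> (l < m)%N -> t k < t l,
        forall k, (k < m)%N -> f (gam i (t k)) != 0 &
        forall k, (k < m)%N ->
          (0 < f (gam i (t (k.+1 %% m)%N))) = ~~ (0 < f (gam i (t k)))].
Proof.
move=> [t [t01 tS fn alt]].
have cg := simple_closed_cont (sc i).
have [m0|m0] := posnP m; first by exists t; split=> // ? ; rewrite m0.
have [s [s0 s1 s01 fs]] : exists s, [/\ t 0%N < s, s < 1,
    (1 < m)%N -> s < t 1%N & 0 < f (gam i s) * f (gam i (t 0%N))].
  have /andP[t00 t011] := t01 0%N m0.
  have tt : 0 <= t 0%N <= 1 by rewrite t00 ltW.
  have tr : trace (gam i) (gam i (t 0%N)).
    by exists (t 0%N) => //=; rewrite in_itv.
  have /nbhs_normP[e /= e0 he] :=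
    sign_near (trace_boundary tr).1 (fn 0%N m0).
  have [d d0 hd] := cg _ tt e e0.
  pose hi := if (1 < m)%N then t 1%N else 1.
  have hi1 : hi <= 1 by rewrite /hi; case: ifP => // /t01 /andP[_ /ltW].
  have thi : t 0%N < hi by rewrite /hi; case: ifP => // /tS.
  pose s := Num.min ((t 0%N + hi) / 2) (t 0%N + d / 2).
  have sd : s <= t 0%N + d / 2 by rewrite ge_min lexx orbT.
  have sh : s <= (t 0%N + hi) / 2 by rewrite ge_min lexx.
  have ts : t 0%N < s by rewrite lt_min; apply/andP; split; lra.
  exists s; split=> //; first lra.
    by move=> m1; move: sh; rewrite /hi m1 in thi *; lra.
  apply: he => /=.
    rewrite distrC; apply: hd; first by apply/andP; split; lra.
    by rewrite gtr0_norm; lra.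
  apply: (trace_boundary (i := i) _).1; exists s => //=; rewrite in_itv /=.
  by apply/andP; split; lra.
pose u k := if k is 0%N then s else t k.
have tmono k l : (k < l)%N -> (l < m)%N -> t k < t l.
  elim: l => // l IH; rewrite ltnS leq_eqVlt => /orP[/eqP -> /tS//|kl lm].
  by apply: lt_trans (tS _ lm); apply: IH => //; exact: ltnW.
have fu k : (k < m)%N -> 0 < f (gam i (u k)) * f (gam i (t k)).
  by case: k => // k km; rewrite /u -expr2 exprn_even_gt0 //= fn.
have signE (a b : R) : 0 < a * b -> (0 < a) = (0 < b).
  move=> ab; apply/idP/idP => h; first by rewrite pmulr_rgt0 in ab.
  by rewrite pmulr_lgt0 in ab.
exists u; split.
- case=> [|k] km; first by rewrite /= s1 andbT; have := t01 0%N m0; lra.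
  have := t01 _ km; have := tmono 0%N k.+1 (ltn0Sn k) km.
  by have := t01 0%N m0; rewrite /=; lra.
- case=> [|k] [|l] // kl lm; last exact: tmono.
  have m1 : (1 < m)%N by apply: leq_ltn_trans lm.
  case: l kl lm => [|l] _ lm; first exact: s01.
  by apply: lt_trans (s01 m1) _; exact: tmono.
- move=> k /fu; apply: contraTneq => ->; by rewrite mul0r ltxx.
- move=> k km; have km' : (k.+1 %% m < m)%N by rewrite ltn_mod.
  rewrite (signE _ _ (fu _ km')) (signE _ _ (fu _ km)).
  have := alt k km; have := fn k km.
  have [h|h|h] := ltgtP 0 (f (gam i (t k))); last by [].
    by rewrite pmulr_rlt0 // => _ ?; apply/negbTE; rewrite -leNgt ltW.
  by rewrite nmulr_rlt0.
Qed.

Lemma sign_witness q (U : set P) : closure Omega q -> f q != 0 -> nbhs q U ->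
  exists x, [/\ Omega x, U x & 0 < f x * f q].
Proof.
move=> cq fq nU; have [x [Ox [Ux hx]]] := cq _ (filterI nU (sign_near cq fq)).
by exists x; split=> //; apply: hx; exact: subset_closure.
Qed.

(** [attach] is applied between the neighbouring sign points, with 0 and 1 for missing ones, so the
    new parameter keeps its rank among the others. *)
Lemma attach_alternating i m (t : nat -> R) k :
  (forall k, (k < m)%N -> 0 < t k < 1) ->
  (forall k l, (k < l)%N -> (l < m)%N -> t k < t l) ->
  (k < m)%N -> 0 < f (gam i (t k)) ->
  exists T x W (K : set P),
    [/\ 0 < T < 1, forall l, (l < m)%N -> l != k -> T != t l /\ (T < t l) = (k < l)%N,
     Omega x /\ 0 < f x, angle_fun W K x (gam i T) &
     forall D, nodal_domains f Omega D -> D x ->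
       K `<=` D `|` [set gam i T]].
Proof.
move=> t01 tmono km fk.
pose lo := if k is k'.+1 then t k' else 0.
pose hi := if (k.+1 < m)%N then t k.+1 else 1.
have lo0 : 0 <= lo.
  by rewrite /lo; case: (k) km => // k' /ltnW /t01 /andP[/ltW].
have hi1 : hi <= 1 by rewrite /hi; case: ifP => // /t01 /andP[_ /ltW].
have lot : lo < t k.
  by rewrite /lo; case: (k) km => [/t01 /andP[]|k' km'] //; exact: tmono.
have thi : t k < hi.
  rewrite /hi; case: ifP => [km'|_]; first exact: tmono.
  by have /andP[] := t01 k km.
have [T [x [W [K [/andP[T1 T2] Ox fx aW KD]]]]] := attach lo0 lot thi hi1 fk.
exists T, x, W, K; split=> //.
  by rewrite (le_lt_trans lo0 T1) (lt_le_trans T2 hi1).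
move=> l lm lk; have [kl|lk'|/eqP] := ltngtP k l; last by rewrite eq_sym (negbTE lk).
- have h : T < t l.
    apply: (lt_le_trans T2); rewrite /hi (leq_ltn_trans kl lm).
    move: kl; rewrite leq_eqVlt => /orP[/eqP <-//|kl].
    exact/ltW/tmono.
  by rewrite h lt_eqF.
- have h : t l < T.
    apply: le_lt_trans T1; rewrite /lo.
    case: (k) km lk' => // k' km'.
    rewrite ltnS leq_eqVlt => /orP[/eqP ->//|kl].
    by apply/ltW/tmono => //; exact: ltnW.
  by rewrite gt_eqF // ltNge ltW.
Qed.

(** The linear system controls sums over the fibres of [h]; grouping by fibres extends this to
    functions of [h x]. *)
Lemma sum_by_value (I J : finType) (A : {set I}) (c : I -> R) (h : I -> J)
    (G : J -> R) :
  \sum_(x in A) c x * G (h x) = \sum_j G j * \sum_(x in A) c x * (h x == j)%:R.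
Proof.
under [RHS]eq_bigr do rewrite mulr_sumr.
rewrite exchange_big; apply: eq_bigr => x _.
rewrite (bigD1 (h x)) //= eqxx mulr1 mulrC big1 ?addr0 // => j jh.
by rewrite eq_sym (negbTE jh) !mulr0.
Qed.

(* Near a point of the curve [i] at parameter [Q], the weighted rotation [w]
   of the cycle made of the paths [V x] and of the end pieces of the curves
   jumps like a multiple of the index of the curve. *)
Lemma jump (I : finType) (A : {set I}) (c : I -> R) (cur : I -> 'I_g.+1)
    (T : I -> R) (V : I -> P -> R) (K : I -> set P) (u : I -> P) i (Q : R) :
  (forall x : I, x \in A -> 0 < T x < 1) ->
  (forall x : I, x \in A -> angle_fun (V x) (K x) (u x) (gam (cur x) (T x))) ->
  (forall G : P -> R, \sum_(x in A) c x * (G (gam (cur x) 1) - G (u x)) = 0) ->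
  0 < Q < 1 ->
  (forall x : I, x \in A -> ~ K x (gam i Q)) ->
  (forall x : I, x \in A -> cur x = i -> T x != Q) ->
  exists C, \forall z \near gam i Q, ~ trace (gam i) z ->
    \sum_(x in A) c x * (V x z + winding (fun r => gam (cur x) r - z) (T x) 1)
      = C + (\sum_(x in A | (cur x == i) && (T x < Q)) c x) * curve_index (gam i) z.
Proof.
move=> T01 aV cyc Q01 KQ TQ; pose q := gam i Q.
(* These are the paths whose end piece passes through [q]. In [W] that piece is replaced by the
   initial piece run backwards, which ends at the same point and avoids [q]. *)
pose b (x : I) := (cur x == i) && (T x < Q).
pose G (x : I) z := winding (fun r => gam (cur x) r - z) (T x) 1.
pose G' (x : I) z := winding (fun r => gam (cur x) r - z) 0 (T x).
pose W (x : I) z := V x z + if b x then - G' x z else G x z.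
pose L (x : I) := K x `|` gam (cur x) @` (if b x then `[0, T x] else `[T x, 1])%classic.
have g01 j : gam j 0 = gam j 1 by have [_ ->] := sc j.
have cg j : cont_on (gam j) 0 1 by exact: simple_closed_cont.
have aW (x : I) : x \in A -> angle_fun (W x) (L x) (u x) (gam (cur x) 1).
  move=> xA; apply: angle_fun_cat (aV x xA) _; have /andP[T0 T1] := T01 x xA.
  case: (b x).
    rewrite -g01; apply: angle_funN; apply: path_angle_fun; first exact: ltW.
    by apply: cont_on_sub (cg _) => //; exact: ltW.
  apply: path_angle_fun; first exact: ltW.
  by apply: cont_on_sub (cg _) => //; exact: ltW.
have LQ (x : I) : x \in A -> ~ L x q.
  move=> xA [/KQ-/(_ xA)//|[r]]; have /andP[T0 T1] := T01 x xA.
  have QQ : 0 <= Q < 1 by case/andP: Q01 => /ltW -> ->.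
  have inj r' : 0 <= r' <= 1 -> gam (cur x) r' = q -> cur x = i /\ r' = Q.
    move=> r01 rq; have ci : cur x = i.
      apply: (trace_disjoint (z := q)).
        by exists r' => //=; rewrite in_itv.
      by exists Q => //=; rewrite in_itv /=; case/andP: QQ => -> /ltW.
    split=> //; move: rq; rewrite ci /q; have [->|r1] := eqVneq r' 1.
      rewrite -g01 => /(simple_closed_inj (sc i)).
      rewrite lexx ltr01 => /(_ isT QQ) Q0.
      by move: Q01; rewrite -Q0 ltxx.
    move/(simple_closed_inj (sc i)); apply => //.
    by case/andP: r01 => -> r01; rewrite lt_neqAle r1.
  rewrite /b; case: ifPn => [/andP[_ TQx]|nb]; rewrite /= in_itv /= => /andP[r0 r1].
    move/inj => -[|_ rQ]; first by rewrite r0 (le_trans r1) // ltW.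
    by move: r1; rewrite rQ leNgt TQx.
  move/inj => -[|ci rQ]; first by rewrite r1 (le_trans _ r0) // ltW.
  move: nb; rewrite ci eqxx /= -leNgt le_eqVlt eq_sym (negbTE (TQ x xA ci)) /=.
  by rewrite ltNge -rQ r0.
exists (\sum_(x in A) c x * W x q).
have := angle_fun_cycle aW cyc LQ; apply: filterS => z <- nt.
rewrite mulr_suml [X in _ = _ + X]big_mkcondr /= -big_split /=.
apply: eq_bigr => x xA; rewrite -/(b x) /W -/(G x z).
case: (boolP (b x)) => [/andP[/eqP ci _]|_]; last by rewrite addr0.
(* Both pieces together make up the curve, so undoing the replacement adds the index with the weight
   of the path. *)
have <- : G' x z + G x z = curve_index (gam i) z.
  have /andP[T0 T1] := T01 x xA.
  rewrite /curve_index -ci; apply: winding_cat; try exact: ltW.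
    exact: cont_on_addr.
  move=> r r01; rewrite subr_eq0; apply/eqP => rz; apply: nt.
  by exists r; rewrite /= ?in_itv // -ci.
by ring.
Qed.

End Nodal.

(** * The linear system and the bound *)

Theorem theorem4p6 (R : realType) (Omega : set (R * R)%type) (g : nat)
    (gam : 'I_g.+1 -> R -> (R * R)%type) (f : (R * R)%type -> R) (n : nat) :
  domain Omega -> bounded_plane Omega ->
  (forall i, simple_closed_param (gam i)) ->
  (forall i, components (plane_boundary Omega) (trace (gam i))) ->
  (forall i j, trace (gam i) = trace (gam j) -> i = j) ->
  plane_boundary Omega = \bigcup_i trace (gam i) ->
  {within closure Omega, continuous f} ->
  nodal_domains f Omega #= `I_n ->
  forall m : 'I_g.+1 -> nat,
    (forall i, has_sign_changes f (gam i) (m i)) ->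
    (\sum_i m i <= 2 * (n + g - 1))%N.
Proof.
move=> domO _ sc comp gam_inj bndE cf cardN m hm.
rewrite leqNgt; apply/negP => lt_s.
have [oO cO [b Ob]] := domO.
have trb := trace_boundary domO bndE.
have [t ht] := choice (fun i => sign_changes_interior domO sc bndE cf (hm i)).
pose pos i k := 0 < f (gam i (t i k)).
have alt i k : (k < m i)%N -> pos i (k.+1 %% m i)%N = ~~ pos i k.
  by have [_ _ _] := ht i; apply.
pose Pt := {i : 'I_g.+1 & 'I_(m i)}.
(* The positive sign points, half of all, index the unknown weights. *)
pose A : {set Pt} := [set x : Pt | pos (tag x) (tagged x)]%SET.
have cardA : (2 * #|A| = \sum_i m i)%N.
  have -> : #|A| = (\sum_i \sum_(k < m i) pos i k)%N.
    rewrite -sum1_card big_mkcond sig_big_dep /=; apply: eq_bigr => x _.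
    by rewrite inE; case: (pos _ _).
  rewrite big_distrr /=; apply: eq_bigr => i _.
  exact: card_alternating (alt i).
have [x0 x0A] : exists x0, x0 \in A.
  by apply/card_gt0P; move: lt_s; rewrite -cardA; case: #|A|.
have [dom [ndom covdom]] := card_eq_enum cardN.
have in_dom z : Omega z -> f z != 0 -> exists j, dom j z.
  move=> Oz fz; have [j jE] := covdom _ (nodal_component cf Oz fz).
  exists j; rewrite jE; apply: connected_component_refl.
  exact/(nodal_setP cf).
have [rep hrep] := choice (fun j => nodal_nonempty (ndom j)).
have ptb (x : Pt) : trace (gam (tag x)) (gam (tag x) (t (tag x) (tagged x))).
  have [/(_ _ (ltn_ord (tagged x))) /andP[? ?] _ _ _] := ht (tag x).
  by exists (t (tag x) (tagged x)) => //=; rewrite in_itv /=; apply/andP; split; exact: ltW.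
pose att_spec (x : Pt) (d : R * (R * R -> R) * set (R * R) * 'I_n) :=
  let: (T, V, K, j) := d in
  [/\ 0 < T < 1, forall l, (l < m (tag x))%N -> l != tagged x ->
        T != t (tag x) l /\ (T < t (tag x) l) = (tagged x < l)%N,
      0 < f (rep j), angle_fun V K (rep j) (gam (tag x) T) &
      K `<=` dom j `|` [set gam (tag x) T]].
have att x : x \in A -> exists d, att_spec x d.
  rewrite inE => px; have [t01 tmono _ _] := ht (tag x).
  have [T [y [W [K [T01 Tt [Oy fy] aW KD]]]]] :=
    attach_alternating domO sc comp gam_inj bndE cf t01 tmono (ltn_ord (tagged x)) px.
  have [j jy] := in_dom y Oy (lt0r_neq0 fy).
  have [V [K' [K'D aV]]] := connected_open_angle_fun (nodal_open domO (ndom j))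
    (nodal_connected (ndom j)) (hrep j) jy.
  exists (T, fun z => V z + W z, K' `|` K, j); split=> //.
  - by rewrite (nodal_sign cf (ndom j) (hrep j) jy).
  - exact: angle_fun_cat aV aW.
  - by rewrite subUset; split; [move=> z /K'D; left|exact: KD].
have [j0 j0p] : exists j, 0 < f (rep j).
  by have [[[[? ?] ?] j] [_ _ ? _ _]] := att x0 x0A; exists j.
have [d hd] : {d & forall x, x \in A -> att_spec x (d x)}.
  apply: (@choice _ _ (fun x dx => x \in A -> att_spec x dx)) => x.
  have [/att[dx hx]|nx] := boolP (x \in A); first by exists dx.
  by exists (0, fun=> 0, set0, j0).
pose T x := (d x).1.1.1; pose V x := (d x).1.1.2; pose K x := (d x).1.2.
pose dj x := (d x).2.
have {hd} hd x : x \in A -> [/\ 0 < T x < 1,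
    forall l, (l < m (tag x))%N -> l != tagged x ->
      T x != t (tag x) l /\ (T x < t (tag x) l) = (tagged x < l)%N,
    0 < f (rep (dj x)), angle_fun (V x) (K x) (rep (dj x)) (gam (tag x) (T x)) &
    K x `<=` dom (dj x) `|` [set gam (tag x) (T x)]].
  by move=> /hd; rewrite /T /V /K /dj; case: (d x) => [[[? ?] ?] ?].
pose W x z := V x z + winding (fun r => gam (tag x) r - z) (T x) 1.
pose L x := K x `|` gam (tag x) @` `[T x, 1].
have aW x : x \in A -> angle_fun (W x) (L x) (rep (dj x)) (gam (tag x) 1).
  move=> /hd[/andP[T0 T1] _ _ aV _]; apply: angle_fun_cat aV _.
  apply: path_angle_fun; first exact: ltW.
  by apply: cont_on_sub (simple_closed_cont (sc (tag x))) => //; exact: ltW.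
have Lsub x z : x \in A -> L x z ->
    dom (dj x) z \/ exists i, trace (gam i) z.
  move=> /hd[/andP[T0 T1] _ _ _ KD] [/KD[]|[r]]; first by left.
    move=> ->; right; exists (tag x); exists (T x) => //=.
    by rewrite in_itv /= !ltW.
  rewrite /= in_itv /= => /andP[r0 r1] <-; right; exists (tag x); exists r => //=.
  by rewrite in_itv /= r1 (le_trans _ r0) // ltW.
have neg_near i k (U : set (R * R)) : (k < m i)%N -> ~~ pos i k ->
    nbhs (gam i (t i k)) U -> exists y, [/\ Omega y, U y & f y < 0].
  move=> km nk nU; have [t01 _ fn _] := ht i.
  have [/andP[? ?] fk] := (t01 k km, fn k km).
  have ck : closure Omega (gam i (t i k)).
    apply: (trb i _ _).1; exists (t i k) => //=; rewrite in_itv /=.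
    by apply/andP; split; exact: ltW.
  have [y [Oy Uy fy]] := sign_witness cf ck fk nU.
  exists y; split=> //; move: fy; rewrite nmulr_lgt0 //.
  by rewrite lt_neqAle fk leNgt.
(* The successor of a positive sign point is negative, which provides a negative nodal domain for
   reference. *)
have [y1 Oy1 fy1] : exists2 y, Omega y & f y < 0.
  have km := ltn_ord (tagged x0).
  have km1 : ((tagged x0).+1 %% m (tag x0) < m (tag x0))%N.
    by rewrite ltn_mod (leq_ltn_trans _ km).
  have [|y [Oy _ fy]] := neg_near _ _ setT km1 _ filterT; last by exists y.
  by rewrite alt // negbK; move: x0A; rewrite inE.
have [j1 j1y] := in_dom y1 Oy1 (ltr0_neq0 fy1).
have dom_neg j z : dom j z -> f z < 0 -> (0 < f (rep j)) = false.
  move=> jz fz; rewrite (nodal_sign cf (ndom j) (hrep j) jz).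
  by apply/negbTE; rewrite -leNgt ltW.
have j1n := dom_neg j1 y1 j1y fy1.
have j01 : j0 != j1 by apply: contraTneq j0p => ->; rewrite j1n.
(* There is one equation per nodal domain and per curve, except for [j0], whose equation follows
   from the others, and [j1], the domain of comparison: [n + g + 1 - 2] in all. *)
pose B : {set 'I_n + 'I_g.+1} := (~: [set inl j0; inl j1])%SET.
have BA : (#|B| < #|A|)%N.
  rewrite /B cardsCs finset.setCK cards2 card_sum !card_ord.
  have -> : (inl j0 != inl j1 :> 'I_n + 'I_g.+1) by [].
  by rewrite addnS subSS -(ltn_pmul2l (isT : (0 < 2)%N)) cardA.
pose a (x : Pt) (j : 'I_n + 'I_g.+1) : R := match j with
  | inl j => if 0 < f (rep j) then (dj x == j)%:R else W x (rep j) - W x (rep j1)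
  | inr i => (tag x == i)%:R
  end.
have [c [[x1 x1A cx1] sys]] := underdetermined a BA.
have curve0 i : \sum_(x in A) c x * (tag x == i)%:R = 0.
  by apply: (sys (inr i)); rewrite !inE.
(* Negative domains carry no positive point. The equation of [j0] follows since the total weight,
   summed over the curves, is zero. *)
have dom0 j : \sum_(x in A) c x * (dj x == j)%:R = 0.
  have off i : i != j0 -> \sum_(x in A) c x * (dj x == i)%:R = 0.
    move=> ij0; have [ip|ip] := boolP (0 < f (rep i)).
      have := sys (inl i); rewrite /a ip; apply.
      rewrite !inE negb_or; apply/andP; split; first by [].
      by apply: contraTneq ip => -[->]; rewrite j1n.
    apply: big1 => x /hd[_ _ xp _ _]; have [e|_] := eqVneq; last by rewrite mulr0.
    by move: ip; rewrite -e xp.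
  have [->|] := eqVneq j j0; last exact: off.
  have := sum_by_value A c dj (fun=> 1); rewrite (bigD1 j0) //= mul1r.
  rewrite [X in _ = _ + X]big1 ?addr0 => [<-|i /off ->]; last by rewrite mulr0.
  rewrite (sum_by_value A c tag (fun=> 1)) big1 // => i _.
  by rewrite curve0 mulr0.
have cyc (G : R * R -> R) :
    \sum_(x in A) c x * (G (gam (tag x) 1) - G (rep (dj x))) = 0.
  under eq_bigr => x _ do rewrite mulrBr.
  rewrite sumrB (sum_by_value A c tag (fun i => G (gam i 1))).
  rewrite (sum_by_value A c dj (fun j => G (rep j))).
  by rewrite !big1 ?subrr // => i _; rewrite ?curve0 ?dom0 mulr0.
pose w z := \sum_(x in A) c x * W x z.
have w_near z : (forall x, x \in A -> ~ L x z) -> \forall z' \near z, w z' = w z.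
  exact: angle_fun_cycle aW cyc z.
(* The paths run in positive domains and along the boundary, so [w] is constant on each negative
   domain; the remaining equations identify these constants. *)
have w_neg z : Omega z -> f z < 0 -> w z = w (rep j1).
  move=> Oz fz; have [j jz] := in_dom z Oz (ltr0_neq0 fz).
  have jn := dom_neg j z jz fz.
  have -> : w z = w (rep j).
    apply: (connected_locally_constant (nodal_connected (ndom j))) => // y jy.
    have : \forall y' \near y, w y' = w y.
      apply: w_near => x xA /(Lsub x y xA)[xy|[i /trb[_]]]; last first.
        by apply; case: (nodal_sub cf (ndom j) jy).
      have [_ _ xp _ _] := hd x xA; move: jn.
      rewrite (nodal_sign cf (ndom j) (hrep j) jy).
      by rewrite -(nodal_sign cf (ndom (dj x)) (hrep (dj x)) xy) xp.
    exact: filterS.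
  apply/eqP; rewrite -subr_eq0 -sumrB; apply/eqP.
  have [->|jj1] := eqVneq j j1; first by apply: big1 => x _; rewrite subrr.
  rewrite -[RHS](sys (inl j)) /a ?jn.
    by apply: eq_bigr => x _; rewrite mulrBr.
  rewrite !inE negb_or; apply/andP; split; last by [].
  by apply: contraFneq jn => -[->].
have TQ i k x : x \in A -> (k < m i)%N -> ~~ pos i k -> tag x = i ->
    T x != t i k /\ (T x < t i k) = (tagged x < k)%N.
  move=> xA km nk ti; subst i; have [_ hT _ _ _] := hd x xA.
  by apply: hT => //; apply: contraNneq nk => ->; move: xA; rewrite inE.
(* [k0] is the jump of the index across the curve, and [v] that of [w] between the negative domains
   and the far side; neither depends on the negative point. *)
have key i : exists k0 v, k0 != 0 /\ forall k, (k < m i)%N -> ~~ pos i k ->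
    (\sum_(x in A | (tag x == i) && (tagged x < k)%N) c x) * k0 = v.
  have nb : ~ trace (gam i) b by move=> /trb[].
  have [E [k0 [cE oE ET TE [k00 kE]]]] := other_side (sc i) nb.
  have idxO z : Omega z -> curve_index (gam i) z = curve_index (gam i) b.
    by move=> Oz; apply: (index_connected (sc i) cO) => // y Oy /trb[].
  (* The index is constant on [Omega], which is connected and off the curve, and takes another value
     on [E]. *)
  have EO z : E z -> ~ closure Omega z.
    move=> Ez /(_ E) [|y [Oy Ey]]; first by apply: open_nbhs_nbhs.
    by move: k00; rewrite -(kE y Ey) idxO // subrr eqxx.
  have w_E z z' : E z -> E z' -> w z = w z'.
    move=> Ez Ez'; apply: (connected_locally_constant cE) => // y Ey.
    have : \forall y' \near y, w y' = w y.
      apply: w_near => x xA /(Lsub x y xA)[xy|[j /trb[cy _]]]; last exact: EO cy.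
      apply: (EO y Ey); apply: subset_closure.
      exact: (nodal_sub cf (ndom (dj x)) xy).1.
    exact: filterS.
  have [yE [EyE _]] : (E `&` setT) !=set0.
    apply: (TE (gam i 0)); last exact: filterT.
    by exists 0 => //=; rewrite in_itv /= lexx ler01.
  exists k0, (w yE - w (rep j1)); split=> // k km nk.
  have [t01 _ _ _] := ht i; have Q01 := t01 k km.
  have tQ : trace (gam i) (gam i (t i k)).
    by exists (t i k) => //=; rewrite in_itv /=; case/andP: Q01 => /ltW -> /ltW.
  have KQ x : x \in A -> ~ K x (gam i (t i k)).
    move=> xA; have [T01 _ _ _ KD] := hd x xA.
    move=> /KD[/(nodal_sub cf (ndom (dj x)))[Oq _]|e]; first exact: (trb i _ tQ).2.
    have ti : tag x = i.
      apply: (trace_disjoint comp gam_inj (z := gam i (t i k))) => //.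
      by exists (T x) => //=; rewrite in_itv /=; case/andP: T01 => /ltW -> /ltW.
    have [/eqP nT _] := TQ i k x xA km nk ti; apply: nT.
    move: e; rewrite ti => e; apply: (simple_closed_inj (sc i)) => //.
      by case/andP: T01 => /ltW ->.
    by case/andP: Q01 => /ltW ->.
  have [|||C hC] := jump sc comp gam_inj (A := A) (c := c) (cur := tag) (T := T)
    (V := V) (K := K) (u := fun x => rep (dj x)) _ _ cyc Q01 KQ _.
  - by move=> x /hd[].
  - by move=> x /hd[].
  - by move=> x xA ti; have [] := TQ i k x xA km nk ti.
  (* Comparing [jump] at a negative point of [Omega] and at a point of [E] eliminates [C]. *)
  have [x' [Ox' hx' fx']] := neg_near i k _ km nk hC.
  have [y' [Ey' hy']] := TE _ tQ _ hC.
  have e1 := hx' (fun tx => (trb i _ tx).2 Ox'); have e2 := hy' (ET _ Ey').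
  rewrite -(kE y' Ey') (w_E yE y') // -(w_neg x' Ox' fx') -(idxO x' Ox').
  rewrite [w y']e2 [w x']e1.
  rewrite (eq_bigl (fun x => (x \in A) && ((tag x == i) && (T x < t i k)))).
    by ring.
  move=> x /=; apply/andb_id2l => xA; apply/andb_id2l => /eqP ti.
  by have [_ ->] := TQ i k x xA km nk ti.
pose i1 := tag x1.
(* The weights on the curve [i1] by position, with empty sums at the negative sign points. *)
pose cc l := \sum_(x in A | (tag x == i1) && (tagged x == l :> nat)) c x.
have below k : \sum_(l < k) cc l =
    \sum_(x in A | (tag x == i1) && (tagged x < k)%N) c x.
  elim: k => [|k IH]; first by rewrite big_ord0 big_pred0 // => x; rewrite !andbF.
  rewrite big_ord_recr IH [RHS](bigID (fun x : Pt => (tagged x < k)%N)) /=.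
  congr (_ + _); apply: eq_bigl => x; rewrite -!andbA; do 2 congr andb.
    by rewrite ltnS; case: ltngtP.
  by rewrite ltnS; case: ltngtP.
suff : cc (tagged x1) = 0.
  rewrite /cc (big_pred1 x1) => [/eqP|x]; first by rewrite (negbTE cx1).
  apply/idP/eqP => [/and3P[_ /eqP]|->]; last by rewrite x1A !eqxx.
  rewrite /i1; case: x x1 {x1A cx1 i1 cc below} => [i k] [i' k'] /= e.
  by subst i' => /eqP/val_inj ->.
have [k0 [v [k00 hk]]] := key i1.
apply: (alternating_partial_sums (m := m i1) (s := pos i1)) => //.
- exact: alt.
- move=> k km nk; rewrite /cc big_pred0 // => x; apply/negP => /and3P[xA /eqP ti].
  by move=> /eqP tk; move: nk; rewrite -tk -ti; move: xA; rewrite inE => ->.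
- rewrite below big_mkcondr -[RHS](curve0 i1); apply: eq_bigr => x _.
  have [e|_] := eqVneq (tag x) i1; last by rewrite mulr0.
  by rewrite mulr1 -e ltn_ord.
- move=> k l km lm nk nl; apply: (mulIf k00); rewrite !below.
  by rewrite (hk k) // (hk l).
Qed.
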